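(* Let $\nu=(\nu_1>\cdots>\nu_{2m}>0)$ be a strict partition of even length $2m\le n$. Then $$GQ_\nu(x_1,\dots,x_n)=\mathrm{Pf}\Big(\sum_{k=0}^\infty\sum_{l=0}^\infty\beta^{k+l}\binom{i+1-2m}{k}\binom{j-2m}{l}\,GQ_{(\nu_i+k,\nu_j+l)}(x_1,\dots,x_n)\Big)_{1\le i<j\le 2m}.$$
   Context: Multiplicative formal group law: $x\oplus y:=x+y+\beta xy$, $\bar x:=-x/(1+\beta x)$, $x\ominus y:=x\oplus\bar y=(x-y)/(1+\beta y)$, with $\beta$ a formal parameter. $x_1,\dots,x_n$ are indeterminates. $K$-theoretic $Q$-functions: for a strict partition $\nu$ of length $r\le n$, $GQ_\nu(x_1,\dots,x_n):=\sum_{\bar w\in S_n/(S_1)^r\times S_{n-r}}w\cdot\big[\prod_{i=1}^r(x_i\oplus x_i)x_i^{\nu_i-1}\prod_{i=1}^r\prod_{j=i+1}^n\frac{x_i\oplus x_j}{x_i\ominus x_j}\big]$ ($S_n$ permuting the $x$'s, sum over coset representatives). For arbitrary positive integers $a,b$ define $GQ_{(a,b)}(x_1,\dots,x_n):=[u_1^{-a}u_2^{-b}]\Big(G(u_1)G(u_2)\frac{u_2\ominus u_1}{u_2\oplus u_1}\Big)$, where $G(u):=\frac{1}{1+\beta u}\prod_{j=1}^n\frac{u\oplus x_j}{u\ominus x_j}$; this agrees with the previous definition when $a>b$. Expansion convention: expand in powers of the $x_j$ (denominators $u\ominus x_j$ in powers of $x_j$), and $1/(u_2\oplus u_1)$ in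 powers of $u_1$ with coefficients Laurent in $u_2$; $[m](\cdot)$ is the coefficient of the monomial $m$. $\binom{N}{k}=N(N-1)\cdots(N-k+1)/k!$ for any integer $N$ (generalized binomial coefficient). $\mathrm{Pf}(a_{ij})_{1\le i<j\le 2m}$ is the Pfaffian of the skew-symmetric $2m\times2m$ matrix with upper entries $a_{ij}$. *)

(* Defs.v *)
From HB Require Import structures.
From mathcomp Require Import all_boot all_order all_algebra all_fingroup.
From mathcomp Require Import fraction.
From Stdlib Require Import ClassicalEpsilon.

Set Implicit Arguments.
Unset Strict Implicit.
Unset Printing Implicit Defensive.

Import Order.TTheory GRing.Theory Num.Theory.
Local Open Scope ring_scope.

(* Coefficient ring Z[beta] = {poly int} (beta = 'X), and the polynomial    *)
(* ring MP n = Z[beta][x_1,...,x_n], built as an iterated polynomial ring:  *)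
(* MP 0 = Z[beta], MP (n+1) = (MP n)[x_{n+1}].                              *)
Fixpoint MP (n : nat) : idomainType :=
  match n with
  | 0 => ({poly int} : idomainType)
  | n'.+1 => ({poly MP n'} : idomainType)
  end.

Fixpoint cst (n : nat) : {poly int} -> MP n :=
  match n return {poly int} -> MP n with
  | 0 => fun c => c
  | n'.+1 => fun c => ((@cst n' c)%:P : {poly MP n'})
  end.

Definition beta (n : nat) : MP n := cst n 'X.

(* var n i = x_{i+1}  (0-indexed, i < n) *)
Fixpoint var (n : nat) : nat -> MP n :=
  match n return nat -> MP n with
  | 0 => fun _ => 0
  | n'.+1 => fun i => if i == n' then ('X : {poly MP n'})
                      else ((@var n' i)%:P : {poly MP n'})
  end.

(* comp n d p = homogeneous component of x-degree d of p (beta has x-degree 0) *)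
Fixpoint comp (n : nat) : nat -> MP n -> MP n :=
  match n return nat -> MP n -> MP n with
  | 0 => fun d c => if d == 0%N then c else 0
  | n'.+1 => fun d (p : {poly MP n'}) =>
      (\sum_(k < d.+1) (@comp n' (d - k)%N p`_k)%:P * 'X^k : {poly MP n'})
  end.

(* Formal power series in x_1..x_n over Z[beta], represented by the         *)
(* sequence of their homogeneous x-degree components:  f = sum_d f d.       *)
Definition Ser (n : nat) := nat -> MP n.

Definition polyS n (p : MP n) : Ser n := fun d => comp d p.
Definition addS n (f g : Ser n) : Ser n := fun d => f d + g d.
Definition subS n (f g : Ser n) : Ser n := fun d => f d - g d.
(* multiplication by a constant of Z[beta] (x-degree 0) *)
Definition scaleS n (c : MP n) (f : Ser n) : Ser n := fun d => c * f d.
Definition mulS n (f g : Ser n) : Ser n :=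
  fun d => \sum_(i < d.+1) f i * g (d - i)%N.

Definition evlim (R : Type) (x0 : R) (s : nat -> R) : R :=
  epsilon (inhabits x0) (fun v => exists N, forall M, (N <= M)%N -> s M = v).

(* infinite sum sum_{k>=0} F k, in the x-adic topology (coefficientwise
   eventually constant partial sums) *)
Definition sumS n (F : nat -> Ser n) : Ser n :=
  fun d => evlim 0 (fun N => \sum_(k < N) F k d).

(* Pfaffian of the skew-symmetric 2m x 2m matrix with upper entries a i j   *)
(* (1 <= i < j <= 2m), by expansion along the first row:                    *)
(*   Pf = sum_{j=2}^{2m} (-1)^j a_{1j} Pf(A with rows/columns 1, j deleted) *)
Definition rem_at (T : Type) (p : nat) (s : seq T) : seq T :=
  take p s ++ drop p.+1 s.

Fixpoint pf_aux (R : comPzRingType) (a : nat -> nat -> R) (m : nat)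
    (l : seq nat) : R :=
  match m with
  | 0 => 1
  | m'.+1 =>
      match l with
      | [::] => 0
      | i :: rest =>
          \sum_(p < size rest)
             (-1) ^+ p * a i (nth 0%N rest p) * pf_aux a m' (rem_at p rest)
      end
  end.

Definition Pf (R : comPzRingType) (m : nat) (a : nat -> nat -> R) : R :=
  pf_aux a m (iota 1 (2 * m)).

(* Pfaffian with power series entries: the x-degree-d component is computed
   from the truncations of the entries to x-degree <= d (computed in the
   polynomial ring (MP n)[t], t marking the x-degree). *)
Definition PfS n (m : nat) (A : nat -> nat -> Ser n) : Ser n :=
  fun d => (Pf m (fun i j => (\poly_(e < d.+1) A i j e : {poly MP n})))`_d.

Definition gbinom (N : int) (k : nat) : int :=
  divz (\prod_(i < k) (N - i%:Z)) (k`!)%:Z.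

(* H(u) := prod_j (u (+) x_j)/(u (-) x_j) = sum_{q>=0} h_q u^{-q}, expanded *)
(* in powers of x_j.  For one factor:                                       *)
(*   (u(+)x)/(u(-)x) = (1+bx)(u+x+bux) sum_{s>=0} x^s u^{-s-1},             *)
(* whose coefficient of u^{-q} is  fq x q  below.                           *)
Definition fq n (y : MP n) (q : nat) : MP n :=
  (1 + beta n * y) * ((1 + beta n * y) * y ^+ q + (0 < q)%N%:R * y ^+ q).

Definition h n (q : nat) : MP n :=
  \sum_(c : {ffun 'I_n -> 'I_q.+1} | (\sum_(j < n) (c j : nat) == q)%N)
     \prod_(j < n) fq (var n j) (c j).

Definition hz n (z : int) : MP n := if z is Posz q then h n q else 0.

(* Cser e p = [u^p] ((1 + beta u)^e H(u)),  with (1+beta u)^e expanded as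
   sum_i binom(e,i) beta^i u^i (beta formal). *)
Definition Cser n (e p : int) : Ser n :=
  sumS (fun i => polyS ((gbinom e i)%:~R * beta n ^+ i * hz n (i%:Z - p))).

(* With G(u) = H(u)/(1+beta u), u2(-)u1 = (u2-u1)/(1+beta u1) and
   1/(u2(+)u1) = sum_k (-1)^k u1^k (1+beta u2)^k u2^{-k-1}  (powers of u1):
   G(u1)G(u2)(u2(-)u1)/(u2(+)u1)
     = sum_k (-1)^k [(1+bu1)^{-2} H(u1) u1^k] [(1+bu2)^{k-1} H(u2) u2^{-k-1}]
                  (u2 - u1),
   so [u1^{-a} u2^{-b}] of it is the following series. *)
Definition GQ2 n (a b : nat) : Ser n :=
  sumS (fun k =>
    scaleS ((-1) ^+ k)
      (subS (mulS (Cser n (-2) (- (a + k)%N%:Z))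
                  (Cser n (k%:Z - 1) (k%:Z - b%:Z)))
            (mulS (Cser n (-2) (- (a + k).+1%:Z))
                  (Cser n (k%:Z - 1) (k%:Z - b%:Z + 1))))).

Definition toF n (p : MP n) : {fraction MP n} := FracField.tofrac p.
Definition xf n (i : 'I_n) : {fraction MP n} := toF (var n i).
Definition betaF n : {fraction MP n} := toF (beta n).

Definition oplus n (x y : {fraction MP n}) := x + y + betaF n * x * y.
Definition obar n (x : {fraction MP n}) := - x / (1 + betaF n * x).
Definition ominus n (x y : {fraction MP n}) := oplus x (obar y).

Definition GQterm n (nu : seq nat) (y : 'I_n -> {fraction MP n}) :
    {fraction MP n} :=
  \prod_(i < n | (i < size nu)%N)
     (oplus (y i) (y i) * y i ^+ (nth 0%N nu i).-1 *
      \prod_(j < n | (i < j)%N) (oplus (y i) (y j) / ominus (y i) (y j))).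

(* sum over coset representatives of S_n/(S_1)^r x S_{n-r}: permutations
   increasing on the positions r+1..n *)
Definition GQnu n (nu : seq nat) : {fraction MP n} :=
  \sum_(w : 'S_n | [forall i : 'I_n, forall j : 'I_n,
                     ((size nu <= i) && (i < j))%N ==> (w i < w j)%N])
     GQterm nu (fun i => xf (w i)).

(* The Pfaffian entries (1-indexed i < j).                                  *)
Definition nuAt (nu : seq nat) (i : nat) : nat := nth 0%N nu i.-1.

Definition entry n (m : nat) (nu : seq nat) (i j : nat) : Ser n :=
  sumS (fun k => sumS (fun l =>
    scaleS ((gbinom (Posz i.+1 - Posz (2 * m)) k
             * gbinom (Posz j - Posz (2 * m)) l)%:~R * beta n ^+ (k + l))
           (GQ2 n (nuAt nu i + k) (nuAt nu j + l)))).

Definition PfRHS n (m : nat) (nu : seq nat) : Ser n := PfS m (entry n m nu).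

(* Main.v *)
Require Import Defs.
From HB Require Import structures.
From mathcomp Require Import all_boot all_order all_algebra all_fingroup fraction.
From mathcomp Require Import ring zify.
From mathcomp Require boolp.
From Stdlib Require ClassicalEpsilon.
Set Implicit Arguments.
Unset Strict Implicit.
Unset Printing Implicit Defensive.
Import GRing.Theory.
Local Open Scope ring_scope.

(* Writing t x_p for x_p turns a power series in the x's, graded by degree,   *)
(* into an element of K[[t]] with K the field of fractions of Z[beta][x].     *)
(* There h_q = sum_p r_p x_p^(q-1) for q >= 1, where r_p is the residue of    *)
(* H(u) at u = x_p. Extracting the coefficient of u1 first replaces u1 by     *)
(* x_p; the factor u2 (+) x_p in the denominator then cancels against H(u2),  *)
(* and the (i, j) entry of the matrix becomes sum_(p,q) B_ip B_jq T_pq with   *)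
(*   T_pq = (x_q - x_p) / (x_q (+) x_p),                                      *)
(*   B_ip = r_p x_p^(nu_i - 1) (1 + beta x_p)^(i - 2m - 1).                   *)
(* By multilinearity the Pfaffian is the sum over (p_1, ..., p_2m) of         *)
(* B_1p_1 ... B_2mp_2m Pf(T_(p_i p_j)). Schur's Pfaffian evaluates the last   *)
(* factor and kills the non-injective choices; the injective ones are the     *)
(* coset representatives, and their terms are those of GQ_nu. Finally,        *)
(* prod_(i != j) (x_i - x_j) is homogeneous and clears the denominators of    *)
(* GQ_nu, so the power series is a polynomial.                                *)

(** * Formal power series *)

(** The computation of an entry rests on residues. [hcoef_residue] and [cser_power_sum] turn the
    coefficient of a negative power of u1 into a sum of values at the poles x_p; at such a pole the
    expanded kernel telescopes ([gq2_sum]) and leaves r_p r'_pq, where r'_pq is the residue at x_q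
    of H with x_p deleted. The binomial sums of an entry only raise the exponents of 1 + beta x_p
    and 1 + beta x_q ([entry_outer_sum]). Since r'_pq = r_q T_pq / (1 + beta x_p), the entry is a
    bilinear form in the B's ([entry_bilin]); the denominator here is why the binomials have i+1 in
    the row but j in the column. After [pf_aux_expand] and [schur_pf], the term of a tuple is a
    product of residues times Schur's product. The residue of the i-th index contains the quotients
    against all other variables. The quotients against earlier indices cancel with Schur's factors
    and leave powers of 1 + beta x; the i-th index collects 2m-i of them, which the shift i-2m in
    the exponent compensates ([fterm_head_tuple]). Partial fractions need a field, so these
    identities are proved in L = Frac(K[[t]]), although the residues themselves are power series
    ([residue_series]). The map [sigma], sending x_p to t x_p, places the rational function GQ_nu in
    the same field ([sigma_GQnu], [emb_PfRHS]), and [polynomial_of_disc_multiple] descends from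
    there to a polynomial. *)

Definition series (R : Type) := nat -> R.

HB.instance Definition _ (R : Type) := boolp.gen_eqMixin (series R).
HB.instance Definition _ (R : Type) := boolp.gen_choiceMixin (series R).

Section SeriesRing.
Variable R : idomainType.
Implicit Types f g h : series R.

Definition ps_opp f : series R := fun d => - f d.
Definition ps_add f g : series R := fun d => f d + g d.
Definition ps_const (c : R) : series R := fun d => if d == 0%N then c else 0.
Definition ps_mul f g : series R := fun d => \sum_(i < d.+1) f i * g (d - i)%N.

Lemma ps_addA : associative ps_add.
Proof. by move=> f g h; apply: boolp.funext => d; rewrite /ps_add addrA. Qed.
Lemma ps_addC : commutative ps_add.
Proof. by move=> f g; apply: boolp.funext => d; rewrite /ps_add addrC. Qed.
Lemma ps_add0 : left_id (ps_const 0) ps_add.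
Proof.
by move=> f; apply: boolp.funext => d; rewrite /ps_add /ps_const if_same add0r.
Qed.
Lemma ps_addN : left_inverse (ps_const 0) ps_opp ps_add.
Proof.
by move=> f; apply: boolp.funext => d; rewrite /ps_add /ps_const if_same addNr.
Qed.
HB.instance Definition _ :=
  GRing.isZmodule.Build (series R) ps_addA ps_addC ps_add0 ps_addN.

Definition ps_trunc D f : {poly R} := \poly_(e < D.+1) f e.

(** Low coefficients of a product see only truncations, so the ring laws are inherited from
    polynomials. *)
Lemma ps_mul_trunc D d f g : (d <= D)%N ->
  ps_mul f g d = (ps_trunc D f * ps_trunc D g)`_d.
Proof.
move=> dD; rewrite coefM; apply: eq_bigr => i _.
by rewrite !coef_poly !ltnS (leq_trans (leq_subr _ _) dD)
           (leq_trans _ dD) // -ltnS.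
Qed.

Lemma ps_mulC : commutative ps_mul.
Proof.
move=> f g; apply: boolp.funext => d.
by rewrite !(@ps_mul_trunc d) // mulrC.
Qed.

Lemma ps_mulA : associative ps_mul.
Proof.
have half f g h d :
  ps_mul f (ps_mul g h) d = (ps_trunc d f * (ps_trunc d g * ps_trunc d h))`_d.
  rewrite coefM {1}/ps_mul; apply: eq_bigr => i _.
  by rewrite (@ps_mul_trunc d) ?leq_subr // coef_poly ltn_ord.
move=> f g h; apply: boolp.funext => d.
rewrite half -[RHS]/(ps_mul (ps_mul f g) h d) ps_mulC half.
by rewrite mulrA [in RHS]mulrC.
Qed.

Lemma ps_mul1 : left_id (ps_const 1) ps_mul.
Proof.
move=> f; apply: boolp.funext => d; rewrite /ps_mul big_ord_recl /=.
rewrite /ps_const eqxx mul1r subn0 big1 ?addr0 // => i _.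
by rewrite /= mul0r.
Qed.

Lemma ps_mulDl : left_distributive ps_mul ps_add.
Proof.
move=> f g h; apply: boolp.funext => d; rewrite /ps_mul /ps_add.
by rewrite -big_split; apply: eq_bigr => i _; rewrite mulrDl.
Qed.

Lemma ps_one_neq0 : ps_const 1 != ps_const 0.
Proof.
apply/eqP => /(congr1 (fun f => f 0%N)); rewrite /ps_const eqxx => /eqP.
by rewrite oner_eq0.
Qed.

HB.instance Definition _ :=
  GRing.Zmodule_isComNzRing.Build (series R) ps_mulA ps_mulC ps_mul1 ps_mulDl
    ps_one_neq0.

Lemma ps_addE f g d : (f + g) d = f d + g d. Proof. by []. Qed.
Lemma ps_oppE f d : (- f) d = - f d. Proof. by []. Qed.
Lemma ps_mulE f g d : (f * g) d = \sum_(i < d.+1) f i * g (d - i)%N.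
Proof. by []. Qed.
Lemma ps_0E d : (0 : series R) d = 0.
Proof. by rewrite -[LHS]/(ps_const 0 d) /ps_const if_same. Qed.
Lemma ps_1E d : (1 : series R) d = (d == 0%N)%:R.
Proof. by rewrite -[LHS]/(ps_const 1 d) /ps_const; case: ifP. Qed.

Lemma ps_sumE I (r : seq I) (P : pred I) (F : I -> series R) d :
  (\sum_(i <- r | P i) F i) d = \sum_(i <- r | P i) F i d.
Proof. by elim/big_rec2: _ => [|i y1 y2 _ <-]; rewrite ?ps_0E. Qed.

Lemma psP f g : (forall d, f d = g d) -> f = g.
Proof. exact: boolp.funext. Qed.

Lemma ps_const_zmod : zmod_morphism ps_const.
Proof.
move=> a c; apply: psP => d; rewrite ps_addE ps_oppE /ps_const.
by case: ifP => //; rewrite subr0.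
Qed.
HB.instance Definition _ :=
  GRing.isZmodMorphism.Build R (series R) ps_const ps_const_zmod.

Lemma ps_constM c f d : (ps_const c * f) d = c * f d.
Proof.
rewrite ps_mulE big_ord_recl subn0 {1}/ps_const eqxx big1 ?addr0 // => i _.
by rewrite /ps_const /= mul0r.
Qed.

Lemma ps_const_monoid : monoid_morphism ps_const.
Proof.
split=> // a c; apply: psP => d; rewrite ps_constM /ps_const.
by case: ifP; rewrite ?mulr0.
Qed.
HB.instance Definition _ :=
  GRing.isMonoidMorphism.Build R (series R) ps_const ps_const_monoid.

Definition ps_t : series R := fun d => (d == 1%N)%:R.

Lemma ps_tM f d : (ps_t * f) d = if d is d'.+1 then f d' else 0.
Proof.
rewrite ps_mulE; case: d => [|d]; first by rewrite big_ord1 mul0r.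
rewrite 2!big_ord_recl /ps_t /= mul0r add0r mul1r subSS subn0 big1 ?addr0 //.
by move=> i _; rewrite mul0r.
Qed.

Lemma ps_tXM k f d : (ps_t ^+ k * f) d = if (k <= d)%N then f (d - k)%N else 0.
Proof.
elim: k f d => [|k IHk] f d; first by rewrite mul1r subn0.
by rewrite exprS -mulrA ps_tM; case: d => // d; rewrite IHk subSS.
Qed.

(** Membership in the ideal generated by t^k. Stated as a bound rather than a valuation, it covers
    the zero series. *)
Definition ord_ge k f := forall d, (d < k)%N -> f d = 0.

Lemma ord_ge0 f : ord_ge 0 f. Proof. by []. Qed.
Lemma ord_ge_zero k : ord_ge k 0. Proof. by move=> d _; rewrite ps_0E. Qed.
Lemma ord_geW k l f : (l <= k)%N -> ord_ge k f -> ord_ge l f.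
Proof. by move=> lk H d dl; apply: H; apply: leq_trans lk. Qed.
Lemma ord_geD k f g : ord_ge k f -> ord_ge k g -> ord_ge k (f + g).
Proof. by move=> Hf Hg d dk; rewrite ps_addE Hf ?Hg ?addr0. Qed.
Lemma ord_geN k f : ord_ge k f -> ord_ge k (- f).
Proof. by move=> Hf d dk; rewrite ps_oppE Hf ?oppr0. Qed.
Lemma ord_geM k l f g : ord_ge k f -> ord_ge l g -> ord_ge (k + l) (f * g).
Proof.
move=> Hf Hg d dk; rewrite ps_mulE big1 // => i _.
have [ik|ki] := ltnP i k; first by rewrite Hf ?mul0r.
by rewrite Hg ?mulr0 //; have := ltn_ord i; lia.
Qed.
Lemma ord_geMl k f g : ord_ge k g -> ord_ge k (f * g).
Proof. by move=> Hg; apply: (ord_geM (ord_ge0 f) Hg). Qed.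
Lemma ord_geMr k f g : ord_ge k f -> ord_ge k (f * g).
Proof. by move=> Hg; rewrite mulrC; apply: ord_geMl. Qed.
Lemma ord_ge_sum k I (r : seq I) (P : pred I) (F : I -> series R) :
  (forall i, P i -> ord_ge k (F i)) -> ord_ge k (\sum_(i <- r | P i) F i).
Proof.
by move=> H d dk; rewrite ps_sumE big1 // => i Pi; apply: H.
Qed.
Lemma ord_geX k f : ord_ge 1 f -> ord_ge k (f ^+ k).
Proof.
by move=> Hf; elim: k => // k IHk; rewrite exprS; apply: (ord_geM Hf IHk).
Qed.

Lemma ps_lowest f : f != 0 -> {d | f d != 0 & ord_ge d f}.
Proof.
move=> f0; have ex : exists d, f d != 0.
  apply: boolp.contrapT => H; case/eqP: f0; apply: psP => d; rewrite ps_0E.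
  by apply: boolp.contrapT => fd; apply: H; exists d; apply/eqP.
exists (ex_minn ex); case: ex_minnP => // d fd min e ed.
by apply: contraTeq ed => /min; rewrite -leqNgt.
Qed.

(** The product of the lowest nonzero coefficients is the lowest coefficient of the product. Being a
    domain, [series R] has a fraction field. *)
Lemma ps_mul_eq0 f g : f * g = 0 -> (f == 0) || (g == 0).
Proof.
move=> fg0; apply: boolp.contrapT => /negP; rewrite negb_or => /andP[].
move=> /ps_lowest[d fd Hf] /ps_lowest[e ge Hg].
move/(congr1 (fun u => u (d + e)%N)): fg0; rewrite ps_0E ps_mulE.
have dd : (d < (d + e).+1)%N by rewrite ltnS leq_addr.
rewrite (bigD1 (Ordinal dd)) //= addKn big1 ?addr0 => [/eqP|i].
  by rewrite mulf_eq0 (negbTE fd) (negbTE ge).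
rewrite -val_eqE /= neq_ltn => /orP[id|di]; first by rewrite Hf ?mul0r.
by rewrite Hg ?mulr0 //; have := ltn_ord i; lia.
Qed.

Definition ps_unit : {pred series R} :=
  fun f => boolp.asbool (exists g, g * f = 1).
Definition ps_inv f : series R :=
  if boolp.pselect (exists g, g * f = 1) is left H
  then proj1_sig (boolp.cid H) else f.

Lemma ps_mulVx : {in ps_unit, left_inverse 1 ps_inv *%R}.
Proof.
move=> f /boolp.asboolP H; rewrite /ps_inv; case: boolp.pselect => // H'.
by case: boolp.cid.
Qed.
Lemma ps_unitPl f g : g * f = 1 -> ps_unit f.
Proof. by move=> gf; apply/boolp.asboolP; exists g. Qed.
Lemma ps_inv_out : {in [predC ps_unit], ps_inv =1 id}.
Proof.
move=> f /negP H; rewrite /ps_inv; case: boolp.pselect => // H'.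
by case: H; apply/boolp.asboolP.
Qed.

HB.instance Definition _ :=
  GRing.ComNzRing_hasMulInverse.Build (series R) ps_mulVx ps_unitPl ps_inv_out.
HB.instance Definition _ :=
  GRing.ComUnitRing_isIntegral.Build (series R) ps_mul_eq0.

(** Convergence in the same eventually constant form as in [evlim], so that values transfer to
    [sumS]. *)
Definition is_sum (F : nat -> series R) (v : series R) :=
  forall d, exists N, forall M, (N <= M)%N -> (\sum_(k < M) F k) d = v d.

Lemma is_sum_unique F v w : is_sum F v -> is_sum F w -> v = w.
Proof.
move=> Hv Hw; apply: psP => d; have [N HN] := Hv d; have [M HM] := Hw d.
by rewrite -(HN (maxn N M)) ?leq_maxl // HM ?leq_maxr.
Qed.

Lemma is_sum_ext F G v : F =1 G -> is_sum F v -> is_sum G v.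
Proof.
move=> FG H d; have [N HN] := H d; exists N => M NM; rewrite -(HN M NM).
by congr (_ d); apply: eq_bigr => k _; rewrite FG.
Qed.

Lemma is_sumD F G v w :
  is_sum F v -> is_sum G w -> is_sum (fun k => F k + G k) (v + w).
Proof.
move=> Hv Hw d; have [N HN] := Hv d; have [M HM] := Hw d.
exists (maxn N M) => P; rewrite geq_max => /andP[NP MP].
by rewrite big_split /= !ps_addE (HN P NP) (HM P MP).
Qed.

Lemma is_sum0 : is_sum (fun=> 0) 0.
Proof. by move=> d; exists 0%N => M _; rewrite big1. Qed.

Lemma is_sum_mull c F v : is_sum F v -> is_sum (fun k => c * F k) (c * v).
Proof.
move=> Hv d; rewrite ps_mulE.
(* Coefficient d of the product involves all coefficients up to d of the partial sums, so one bound
   must serve them all. *)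
have : exists N, forall M e, (e <= d)%N -> (N <= M)%N ->
    (\sum_(k < M) F k) e = v e.
  elim: d => [|d [N HN]].
    by have [N HN] := Hv 0%N; exists N => M [|//] _ /HN.
  have [N' HN'] := Hv d.+1; exists (maxn N N') => M e.
  rewrite geq_max leq_eqVlt => /orP[/eqP->|ed] /andP[NM N'M]; first exact: HN'.
  exact: HN.
case=> N HN; exists N => M NM; rewrite -mulr_sumr ps_mulE.
by apply: eq_bigr => i _; rewrite HN // leq_subr.
Qed.

Lemma is_sumN F v : is_sum F v -> is_sum (fun k => - F k) (- v).
Proof.
move=> /(is_sum_mull (-1)); rewrite mulN1r; apply: is_sum_ext => k.
by rewrite mulN1r.
Qed.

Lemma is_sum_sum I (r : seq I) (P : pred I) (F : I -> nat -> series R) v :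
  (forall i, P i -> is_sum (F i) (v i)) ->
  is_sum (fun k => \sum_(i <- r | P i) F i k) (\sum_(i <- r | P i) v i).
Proof.
move=> H; elim: r => [|i r IHr].
  rewrite big_nil; apply: is_sum_ext is_sum0 => k; by rewrite big_nil.
rewrite big_cons; case: ifP => Pi.
  apply: is_sum_ext (is_sumD (H _ Pi) IHr) => k; by rewrite big_cons Pi.
by apply: is_sum_ext IHr => k; rewrite big_cons Pi.
Qed.

Lemma is_sum_shift F v : is_sum (fun k => F k.+1) v -> is_sum F (F 0%N + v).
Proof.
move=> H d; have [N HN] := H d; exists N.+1 => -[//|M] NM.
by rewrite big_ord_recl ps_addE HN.
Qed.

Lemma is_sum_telescope (D : nat -> series R) :
  (forall k, ord_ge k (D k)) -> is_sum (fun k => D k - D k.+1) (D 0%N).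
Proof.
move=> H d; exists d.+1 => M dM.
have -> : \sum_(k < M) (D k - D k.+1) = D 0%N - D M.
  elim: M {dM} => [|M IHM]; first by rewrite big_ord0 subrr.
  by rewrite big_ord_recr IHM /= addrA subrK.
by rewrite ps_addE ps_oppE (H M) // subr0.
Qed.

(** Coefficient d is constant from c + d + 1 terms on. The offset c accommodates the shift by p in
    [cterm]. *)
Lemma is_sum_exists c (F : nat -> series R) :
  (forall k, ord_ge (k - c) (F k)) -> exists v, is_sum F v.
Proof.
move=> H; exists (fun d => (\sum_(k < (c + d).+1) F k) d) => d.
exists (c + d).+1 => M dM; rewrite !ps_sumE (big_ord_widen _ (fun k => F k d) dM).
rewrite [LHS](bigID (fun k : 'I_M => (k < (c + d).+1)%N)) /=.
rewrite [X in _ + X]big1 ?addr0 // => i; rewrite -leqNgt => di.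
by apply: H; lia.
Qed.
End SeriesRing.

Section SeriesMap.
Variables (R S : idomainType) (phi : {rmorphism R -> S}).
Definition ps_map (f : series R) : series S := fun d => phi (f d).

Lemma ps_map_zmod : zmod_morphism ps_map.
Proof. by move=> f g; apply: psP => d; rewrite /ps_map raddfB. Qed.
HB.instance Definition _ :=
  GRing.isZmodMorphism.Build (series R) (series S) ps_map ps_map_zmod.
Lemma ps_map_monoid : monoid_morphism ps_map.
Proof.
split=> [|f g]; apply: psP => d.
  by rewrite /ps_map !ps_1E rmorph_nat.
rewrite /ps_map !ps_mulE rmorph_sum; apply: eq_bigr => i _; by rewrite rmorphM.
Qed.
HB.instance Definition _ :=
  GRing.isMonoidMorphism.Build (series R) (series S) ps_map ps_map_monoid.
End SeriesMap.

(** * The binomial series *)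

Definition fallz (N : int) (k : nat) : int := \prod_(i < k) (N - i%:Z).

Lemma fallzSr N k : fallz N k.+1 = fallz N k * (N - k%:Z).
Proof. by rewrite /fallz big_ord_recr. Qed.

Lemma fallzSl N k : fallz (N + 1) k.+1 = (N + 1) * fallz N k.
Proof.
rewrite /fallz big_ord_recl subr0; congr (_ * _); apply: eq_bigr => i _.
by rewrite /= /bump /= PoszD; ring.
Qed.

Lemma fallz_diff N k : fallz (N + 1) k.+1 = fallz N k.+1 + k.+1%:Z * fallz N k.
Proof. by rewrite fallzSl fallzSr -addn1 PoszD; ring. Qed.

(** Induction on k, then on N in both directions through [fallz_diff]. It makes the division in
    [gbinom] exact for negative N as well. *)
Lemma dvdz_fallz N k : ((k`!)%:Z %| fallz N k)%Z.
Proof.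
elim: k N => [|k IHk] N; first by rewrite dvd1z.
have step M : ((k.+1)`!%:Z %| k.+1%:Z * fallz M k)%Z.
  by rewrite factS PoszM dvdz_mul.
elim: N => [|N IHN|N IHN].
- by rewrite /fallz big_ord_recl subrr mul0r dvdz0.
- by rewrite -addn1 PoszD fallz_diff rpredD.
have E := fallz_diff (- (N.+1)%:Z) k.
have N1 : - (N.+1)%:Z + 1 = - N%:Z by rewrite -addn1 PoszD; ring.
rewrite N1 in E.
have -> : fallz (- (N.+1)%:Z) k.+1 =
  fallz (- N%:Z) k.+1 - k.+1%:Z * fallz (- (N.+1)%:Z) k by rewrite E addrK.
by rewrite rpredB.
Qed.

Lemma gbinom_fact N k : gbinom N k * (k`!)%:Z = fallz N k.
Proof. by rewrite /gbinom divzK // dvdz_fallz. Qed.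

Lemma gbinom0 N : gbinom N 0 = 1.
Proof. by rewrite -[LHS]mulr1 (gbinom_fact N 0) /fallz big_ord0. Qed.

Lemma gbinom_0S k : gbinom 0 k.+1 = 0.
Proof.
have := gbinom_fact 0 k.+1; rewrite /fallz big_ord_recl subrr mul0r.
by move/eqP; rewrite mulf_eq0 eqz_nat -[_ == 0%N]negbK -lt0n fact_gt0 orbF
  => /eqP.
Qed.

Lemma gbinom_pascal N k : gbinom (N + 1) k.+1 = gbinom N k.+1 + gbinom N k.
Proof.
have f0 : (k.+1)`!%:Z != 0 by rewrite eqz_nat -lt0n fact_gt0.
apply: (mulIf f0); rewrite mulrDl !gbinom_fact fallz_diff; congr (_ + _).
by rewrite factS PoszM mulrCA gbinom_fact.
Qed.

Section BinomialSeries.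
Variable R : idomainType.
Implicit Types z : series R.

Definition bterm (e : int) z (i : nat) : series R := (gbinom e i)%:~R * z ^+ i.

(** Pascal's rule, read as multiplication of the binomial series by 1 + z. *)
Lemma is_sum_bterm_succ e z v :
  is_sum (bterm e z) v -> is_sum (bterm (e + 1) z) ((1 + z) * v).
Proof.
move=> H; rewrite mulrDl mul1r.
have Hs : is_sum (fun i => if i is i'.+1 then z * bterm e z i' else 0) (z * v).
  rewrite -[z * v]add0r.
  exact: (@is_sum_shift _
    (fun i => if i is i'.+1 then z * bterm e z i' else 0) _ (is_sum_mull z H)).
apply: is_sum_ext (is_sumD H Hs) => -[|i].
  by rewrite /bterm !gbinom0 addr0.
by rewrite /bterm gbinom_pascal rmorphD mulrDl exprS; ring.
Qed.

Lemma is_sum_bterm0 z : is_sum (bterm 0 z) 1.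
Proof.
have -> : (1 : series R) = bterm 0 z 0 + 0.
  by rewrite /bterm gbinom0 expr0 mulr1 addr0.
apply: is_sum_shift; apply: is_sum_ext (is_sum0 R) => k.
by rewrite /bterm gbinom_0S mul0r.
Qed.

Lemma ord_ge_bterm e z i : ord_ge 1 z -> ord_ge i (bterm e z i).
Proof. by move=> Hz; apply: ord_geMl; apply: ord_geX. Qed.

Lemma bterm_exists e z : ord_ge 1 z -> exists v, is_sum (bterm e z) v.
Proof.
move=> Hz; apply: (@is_sum_exists _ 0) => k.
by rewrite subn0; apply: ord_ge_bterm.
Qed.

(** The inverse is the binomial series of exponent -1: its product with 1 + z is the sum of the
    series of exponent 0, which is 1. *)
Lemma unit_1D z : ord_ge 1 z -> 1 + z \is a GRing.unit.
Proof.
move=> Hz; have [v /is_sum_bterm_succ Hv] := bterm_exists (-1) Hz.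
rewrite addNr in Hv.
have := is_sum_unique Hv (is_sum_bterm0 z) => E.
by apply/unitrPr; exists v.
Qed.

Lemma is_sum_binomial e z : ord_ge 1 z -> is_sum (bterm e z) ((1 + z) ^ e).
Proof.
move=> Hz; have Uz := unit_1D Hz; elim: e => [|e IHe|e IHe].
- exact: is_sum_bterm0.
- by rewrite exprSz -addn1 PoszD; apply: is_sum_bterm_succ.
have [v Hv] := bterm_exists (- (e.+1)%:Z) Hz.
have := is_sum_bterm_succ Hv.
have -> : - (e.+1)%:Z + 1 = - e%:Z by rewrite -addn1 PoszD; ring.
move=> /(is_sum_unique IHe) E.
suff -> : (1 + z) ^ (- (e.+1)%:Z) = v by [].
apply: (mulrI Uz); rewrite -E -{1}[1 + z]expr1z -exprzDr //.
by congr (_ ^ _); rewrite -addn1 PoszD; ring.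
Qed.
End BinomialSeries.

(** An eventual value is unique, so the choice made by [epsilon] is forced. *)
Lemma evlimE (T : Type) (x0 : T) (s : nat -> T) (N : nat) v :
  (forall M, (N <= M)%N -> s M = v) -> evlim x0 s = v.
Proof.
move=> H; rewrite /evlim.
have ex : exists w, exists N, forall M, (N <= M)%N -> s M = w by exists v, N.
have [N' HN'] := ClassicalEpsilon.epsilon_spec (inhabits x0) _ ex.
by rewrite -(HN' (maxn N N')) ?leq_maxr // H ?leq_maxl.
Qed.

(** * Partial fractions *)

Section PartialFractions.
Variables (F : fieldType) (I : eqType) (x al ga : I -> F).
Implicit Types (S : seq I) (y : F).

Definition lin k y := al k * y + ga k.
(* The residue at u = x_p of the product over S of (al_k u + ga_k)/(u - x_k). *)
Definition residue S p :=
  lin p (x p) * \prod_(k <- S | k != p) (lin k (x p) / (x p - x k)).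

Lemma residue_cons_notin S z p : p != z ->
  residue (z :: S) p = residue S p * (lin z (x p) / (x p - x z)).
Proof.
by move=> pz; rewrite /residue big_cons eq_sym pz; ring.
Qed.

Lemma residue_cons_head S z : z \notin S ->
  residue (z :: S) z = lin z (x z) * \prod_(k <- S) (lin k (x z) / (x z - x k)).
Proof.
move=> zS; rewrite /residue big_cons eqxx /=; congr (_ * _).
rewrite [LHS]big_seq_cond [RHS]big_seq; apply: eq_bigl => k.
case: eqVneq => [->|]; by rewrite ?(negbTE zS) ?andbT.
Qed.

(** Numerator and denominator have equal formal degree, hence the constant term, which is the value
    at infinity. Adding a factor splits its pole against each old one. *)
Lemma partial_fractions S y : uniq S -> {in S &, injective x} ->
  (forall k, k \in S -> y != x k) ->
  \prod_(k <- S) (lin k y / (y - x k)) =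
  \prod_(k <- S) al k + \sum_(p <- S) residue S p / (y - x p).
Proof.
elim: S y => [|z S IHS] y; first by rewrite !big_nil addr0.
move=> /= /andP[zS uS] inj yx.
have injS : {in S &, injective x}.
  by move=> u v uS' vS'; apply: inj; rewrite inE ?uS' ?vS' orbT.
have xzS k : k \in S -> x z != x k.
  move=> kS; apply: contraNneq zS => /inj -> //; rewrite inE ?eqxx //.
  by rewrite kS orbT.
have yS k : k \in S -> y != x k by move=> kS; apply: yx; rewrite inE kS orbT.
have yz : y - x z != 0 by rewrite subr_eq0 yx ?inE ?eqxx.
rewrite !big_cons residue_cons_head // !IHS //.
(* Each product of poles at x_p and x_z splits in two. The second sum is the expansion of the old
   product at x_z, which makes up the residue of the new pole. *)
have -> : \sum_(p <- S) residue (z :: S) p / (y - x p) =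
  \sum_(p <- S) residue S p / (y - x p) * (lin z y / (y - x z))
  - \sum_(p <- S) residue S p / (x z - x p) * (lin z (x z) / (y - x z)).
  rewrite -sumrB big_seq [RHS]big_seq; apply: eq_bigr => p pS.
  rewrite residue_cons_notin; last by apply: contraNneq zS => <-.
  have h1 : y - x p != 0 by rewrite subr_eq0 yS.
  have h2 : x z - x p != 0 by rewrite subr_eq0 xzS.
  have h3 : x p - x z != 0 by rewrite subr_eq0 eq_sym xzS.
  rewrite /lin; field; by rewrite h1 h2 h3 yz.
rewrite -!mulr_suml; rewrite /lin; field; by rewrite yz.
Qed.
End PartialFractions.

(** * Schur's product and its summation identity *)

Lemma prodrN_seq (R : comNzRingType) (I : Type) (r : seq I) (P : pred I)
    (f : I -> R) :
  \prod_(i <- r | P i) - f i = (-1) ^+ count P r * \prod_(i <- r | P i) f i.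
Proof.
elim: r => [|i r IHr]; first by rewrite !big_nil mul1r.
rewrite !big_cons IHr /=; case: ifP => _ //=.
by rewrite exprS; ring.
Qed.

Section Schur.
Variable F : fieldType.
Implicit Types (s t : F) (l : seq F).

Definition schurT s t := (t - s) / (t + s).

Lemma schurTN s t : schurT s t = - schurT t s.
Proof. by rewrite /schurT [s + t]addrC -mulNr opprB. Qed.
Lemma schurTxx s : schurT s s = 0. Proof. by rewrite /schurT subrr mul0r. Qed.

(** The value of Schur's Pfaffian: the kernel multiplied over all pairs in list order. *)
Fixpoint delta l := if l is s :: l' then \prod_(t <- l') schurT s t * delta l' else 1.

Lemma delta_move l1 l2 s l3 :
  delta (l1 ++ l2 ++ s :: l3) = (-1) ^+ size l2 * delta (l1 ++ s :: l2 ++ l3).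
Proof.
elim: l1 => [|u l1 IHl1] /=; last first.
  rewrite IHl1 mulrCA; congr (_ * (_ * _)); apply: perm_big.
  rewrite perm_cat2l perm_sym -cat_cons -cat1s -!catA.
  by rewrite -[s :: l3]cat1s perm_catCA.
elim: l2 => [|u l2 IHl2] /=; first by rewrite mul1r.
rewrite IHl2 /= exprS big_cat /= !big_cons !big_cat /= [schurT s u]schurTN.
by ring.
Qed.

Lemma delta_dup l : ~~ uniq l -> delta l = 0.
Proof.
elim: l => //= s l IHl; rewrite negb_and negbK => /orP[sl|/IHl->]; last first.
  by rewrite mulr0.
by rewrite (perm_big _ (perm_to_rem sl)) big_cons /= schurTxx !mul0r.
Qed.

Lemma delta_nth l p : (p < size l)%N ->
  delta l = (-1) ^+ p * \prod_(t <- rem_at p l) schurT (nth 0 l p) t * delta (rem_at p l).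
Proof.
move=> pl; rewrite -{1}(cat_take_drop p l) (drop_nth 0 pl).
have := delta_move [::] (take p l) (nth 0 l p) (drop p.+1 l).
by rewrite /= size_take pl mulrA => ->.
Qed.

Lemma schurT_odd_sum (l : seq F) y : uniq l -> odd (size l) ->
  (forall s t, s \in l -> t \in l -> s + t != 0) ->
  (forall s, s \in l -> y + s != 0) ->
  \sum_(s <- l) schurT y s * \prod_(t <- l | t != s) (schurT s t)^-1 =
  \prod_(s <- l) schurT y s.
Proof.
move=> ul ol l0 y0.
have l0' s : s \in l -> s != 0.
  by move=> sl; apply: contraTneq (l0 _ _ sl sl) => ->; rewrite addr0 eqxx.
pose c s := \prod_(t <- l | t != s) (schurT t s)^-1.
have injN : {in l &, injective (fun s => - s)} by move=> u v _ _ /oppr_inj.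
have PF z : (forall s, s \in l -> z + s != 0) ->
    \prod_(s <- l) ((z - s) / (z + s)) = 1 - \sum_(s <- l) 2 * s * c s / (z + s).
  move=> z0.
  have E : \prod_(s <- l) ((z - s) / (z + s)) = 1 +
     \sum_(s <- l) residue (fun s => - s) (fun=> 1) (fun s => - s) l s / (z + s).
    transitivity (\prod_(s <- l) (lin (fun=> 1) (fun s => - s) s z / (z - - s))).
      by apply: eq_bigr => s _; rewrite /lin mul1r opprK.
    rewrite partial_fractions // => [|k kl]; last by rewrite -subr_eq0 opprK z0.
    congr (_ + _); first by rewrite big1.
    by apply: eq_bigr => s _; rewrite opprK.
  rewrite -sumrN.
  rewrite E; congr (_ + _); rewrite big_seq [RHS]big_seq.
  apply: eq_bigr => s sl; rewrite -mulNr; congr (_ / _).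
  rewrite /residue /lin mul1r -opprD -mulNr; congr (_ * _); first by ring.
  rewrite /c big_seq_cond [RHS]big_seq_cond; apply: eq_bigr => t /andP[tl ts].
  have h1 : t + s != 0 by rewrite l0.
  have h2 : s - t != 0 by rewrite subr_eq0 eq_sym.
  rewrite /schurT; field; rewrite h2 [s + t]addrC h1 /=.
  by rewrite -opprD oppr_eq0.
(* A list of odd length has an element s, and s + s != 0 excludes characteristic 2. *)
have F2 : (2 : F) != 0.
  case: l ol l0 {ul y0 l0' c injN PF} => // s l _ l0.
  have := l0 s s; rewrite mem_head => /(_ isT isT).
  by apply: contraNneq => E; rewrite -[s + s]/(s *+ 2) -mulr_natl E mul0r.
have sgn z : \prod_(s <- l) ((z - s) / (z + s)) = - \prod_(s <- l) schurT z s.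
  have -> : \prod_(s <- l) schurT z s = \prod_(s <- l) (- ((z - s) / (z + s))).
    by apply: eq_bigr => s _; rewrite /schurT -mulNr opprB [s + z]addrC.
  rewrite prodrN_seq -signr_odd count_predT ol expr1 mulN1r opprK //.
(* The expansion at z = 0; this is where the parity of l is needed. *)
have c1 : \sum_(s <- l) c s = 1.
  have := PF 0; rewrite sgn.
  have -> : \prod_(s <- l) schurT 0 s = 1.
    rewrite big_seq big1 // => s sl; rewrite /schurT subr0 addr0 divff //.
    exact: l0'.
  have -> : \sum_(s <- l) 2 * s * c s / (0 + s) = 2 * \sum_(s <- l) c s.
    rewrite mulr_sumr big_seq [RHS]big_seq; apply: eq_bigr => s sl.
    by have := l0' _ sl => s0; rewrite add0r; field.
  have z0 s : s \in l -> 0 + s != 0 by move=> sl; rewrite add0r l0'.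
  move=> /(_ z0) E; apply: (mulfI F2); rewrite mulr1.
  by rewrite -[LHS](subKr 1) -E opprK.
have := PF y y0; rewrite sgn => /(congr1 -%R); rewrite opprK => ->.
(* An even number of elements differ from s, so reversing all the kernels costs no sign. *)
have cE s : s \in l -> \prod_(t <- l | t != s) (schurT s t)^-1 = c s.
  move=> sl; transitivity (\prod_(t <- l | t != s) - (schurT t s)^-1).
    by apply: eq_bigr => t _; rewrite schurTN invrN.
  rewrite prodrN_seq -/(c s) -signr_odd.
  have := count_predC (pred1 s) l; rewrite count_uniq_mem // sl.
  move=> /(congr1 odd); rewrite oddD ol /=; case: (odd _) => // _.
  by rewrite mul1r.
rewrite opprB -[X in _ = _ - X]c1 -sumrB big_seq [RHS]big_seq; apply: eq_bigr => s sl.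
have := y0 _ sl => ys; rewrite cE // /schurT; field; by rewrite ?ys // addrC ys.
Qed.
End Schur.

(** * Pfaffians *)

Section RemAt.
Variable T : eqType.
Implicit Types (l : seq T) (x : T).

Lemma perm_rem_at x0 p l : (p < size l)%N ->
  perm_eq l (nth x0 l p :: rem_at p l).
Proof.
move=> pl; rewrite -{1}(cat_take_drop p l) (drop_nth x0 pl) /rem_at.
by rewrite -cat1s perm_catCA.
Qed.

Lemma mem_rem_at p l : {subset rem_at p l <= l}.
Proof.
by move=> y; rewrite /rem_at mem_cat => /orP[/mem_take|/mem_drop].
Qed.

Lemma size_rem_at p l : (p < size l)%N -> size (rem_at p l) = (size l).-1.
Proof.
case: l => [|x0 l] // pl; have := perm_size (perm_rem_at x0 pl).
by case=> /=  ->.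
Qed.

Lemma uniq_rem_at p l : uniq l -> uniq (rem_at p l).
Proof.
have [pl|lp] := ltnP p (size l); last by rewrite /rem_at take_oversize //
  drop_oversize ?cats0 // (leq_trans lp).
case: l pl => [|x0 l] // pl; rewrite (perm_uniq (perm_rem_at x0 pl)) /=.
by case/andP.
Qed.

Lemma rem_at_notin x0 p l : (p < size l)%N -> uniq l ->
  nth x0 l p \notin rem_at p l.
Proof.
by move=> pl; rewrite (perm_uniq (perm_rem_at x0 pl)) /= => /andP[].
Qed.

Lemma mem_rem_at_neq x0 p l x : (p < size l)%N -> x \in l -> nth x0 l p != x ->
  x \in rem_at p l.
Proof.
move=> pl; rewrite (perm_mem (perm_rem_at x0 pl)) inE => /orP[/eqP->|//].
by rewrite eqxx.
Qed.

Lemma map_rem_at (S : Type) (f : T -> S) p l :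
  map f (rem_at p l) = rem_at p (map f l).
Proof. by rewrite /rem_at map_cat map_take map_drop. Qed.

Lemma rem_at_cat l1 x l2 : rem_at (size l1) (l1 ++ x :: l2) = l1 ++ l2.
Proof.
by rewrite /rem_at take_size_cat // drop_cat ltnNge leqnSn /= subSn // subnn /= drop0.
Qed.

Lemma nth_rem_at x0 p l k : (p < size l)%N ->
  nth x0 (rem_at p l) k = nth x0 l (bump p k).
Proof.
move=> pl; rewrite /rem_at /bump nth_cat size_take pl (leqNgt p k).
case: ltnP => kp /=; first by rewrite nth_take.
by rewrite nth_drop addSn subnKC.
Qed.

Lemma rem_at_dup x0 p i j l : (p < size l)%N -> (i < j)%N -> (j < size l)%N ->
  p != i -> p != j -> nth x0 l i = nth x0 l j -> ~~ uniq (rem_at p l).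
Proof.
move=> pl ij jl pi pj E; apply/(uniqPn x0).
exists (unbump p i), (unbump p j); split.
- by rewrite /unbump; lia.
- by rewrite size_rem_at // /unbump; lia.
by rewrite !nth_rem_at // !unbumpK // inE eq_sym.
Qed.

Lemma not_uniq_cat l : ~~ uniq l -> exists l1 x l2 l3, l = l1 ++ x :: l2 ++ x :: l3.
Proof.
elim: l => //= a l IHl; rewrite negb_and negbK => /orP[|/IHl].
  by move=> al; case/splitPr: al => l2 l3; exists [::], a, l2, l3.
by case=> l1 [x [l2 [l3 ->]]]; exists (a :: l1), x, l2, l3.
Qed.
End RemAt.

Section PfGeneral.
Variable R : comNzRingType.
Implicit Types (a : nat -> nat -> R) (l : seq nat).

Lemma eq_pf_aux a a' m l : {in l &, forall i j, a i j = a' i j} ->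
  pf_aux a m l = pf_aux a' m l.
Proof.
elim: m l => [|m IHm] [|i l] //= H; apply: eq_bigr => p _.
have ml j : j \in rem_at p l -> j \in i :: l.
  by move=> /mem_rem_at jl; rewrite inE jl orbT.
rewrite H ?inE ?eqxx ?mem_nth ?orbT // (IHm (rem_at p l)) // => j k jl kl.
by rewrite H ?ml.
Qed.

Lemma pf_aux_rmorph (S : comNzRingType) (phi : {rmorphism R -> S}) a m l :
  phi (pf_aux a m l) = pf_aux (fun i j => phi (a i j)) m l.
Proof.
elim: m l => [|m IHm] [|i l] /=; rewrite ?rmorph1 ?rmorph0 //.
rewrite rmorph_sum; apply: eq_bigr => p _.
by rewrite !rmorphM rmorphXn rmorphN1 IHm.
Qed.

(** Every monomial of the Pfaffian uses the index i0 exactly once. Both row and column through i0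
    are prescribed, because [a] is not assumed skew and i0 may occur in either place. *)
Lemma pf_aux_linear (U : Type) (r : seq U) (c : U -> R)
    (au : U -> nat -> nat -> R) a i0 m l :
  uniq l -> i0 \in l -> size l = m.*2 ->
  (forall j, j \in l -> j != i0 -> a i0 j = \sum_(u <- r) c u * au u i0 j) ->
  (forall j, j \in l -> j != i0 -> a j i0 = \sum_(u <- r) c u * au u j i0) ->
  (forall u i j, i \in l -> j \in l -> i != i0 -> j != i0 -> a i j = au u i j) ->
  pf_aux a m l = \sum_(u <- r) c u * pf_aux (au u) m l.
Proof.
elim: m l => [|m IHm] [|i l] //= /andP[il ul] i0l [sl] Hl Hr Ho.
under [RHS]eq_bigr do rewrite mulr_sumr.
rewrite exchange_big /=; apply: eq_bigr => p _.
set j := nth 0%N l p; have jl : j \in l by rewrite mem_nth.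
have ij : j != i by apply: contraNneq il => <-.
have sp : size (rem_at p l) = m.*2 by rewrite size_rem_at // sl.
have up : uniq (rem_at p l) by apply: uniq_rem_at.
have jp : j \notin rem_at p l by apply: rem_at_notin.
have sub k : k \in rem_at p l -> k \in i :: l.
  by move=> /mem_rem_at kl; rewrite inE kl orbT.
have ip : i \notin rem_at p l by apply: contra il => /mem_rem_at.
have jil : j \in i :: l by rewrite inE jl orbT.
have iil : i \in i :: l by rewrite mem_head.
have ext u : i0 \notin rem_at p l ->
    pf_aux a m (rem_at p l) = pf_aux (au u) m (rem_at p l).
  move=> i0p; apply: eq_pf_aux => k k' kl kl'; apply: Ho; rewrite ?sub //.
    by apply: contraNneq i0p => <-.
  by apply: contraNneq i0p => <-.
have [ii0|ii0] := eqVneq i i0.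
  subst i0; rewrite Hl // mulr_sumr mulr_suml; apply: eq_bigr => u _.
  by rewrite (ext u) //; ring.
have [ji0|ji0] := eqVneq j i0.
  rewrite ji0 in jp ij *; rewrite Hr 1?eq_sym // mulr_sumr mulr_suml.
  by apply: eq_bigr => u _; rewrite (ext u) //; ring.
have i0p : i0 \in rem_at p l.
  apply: (mem_rem_at_neq (x0 := 0%N)) => //.
  by move: i0l; rewrite inE eq_sym (negbTE ii0).
rewrite (IHm (rem_at p l)) // ?mulr_sumr; first last.
- by move=> u k k' kl kl'; apply: Ho; rewrite sub.
- by move=> k kl; apply: Hr; rewrite sub.
- by move=> k kl; apply: Hl; rewrite sub.
apply: eq_bigr => u _; rewrite (Ho u i j) //; ring.
Qed.
End PfGeneral.

Lemma big_tuple_cons (R : nmodType) (I : finType) k (G : seq I -> R) :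
  \sum_(t : k.+1.-tuple I) G t = \sum_(u : I) \sum_(t : k.-tuple I) G (u :: t).
Proof.
rewrite pair_big /= (reindex (fun ut : I * k.-tuple I => cons_tuple ut.1 ut.2)) //=.
exists (fun t : k.+1.-tuple I => (thead t, behead_tuple t)) => [[u t]|t] _ /=.
  by congr pair; apply: val_inj.
by apply: val_inj => /=; rewrite [t in RHS]tuple_eta.
Qed.

Section PfExpansion.
Variables (R : comNzRingType) (I : finType) (T : I -> I -> R).

Definition bilin (rho : nat -> I -> R) (i j : nat) : R :=
  \sum_u \sum_v rho i u * rho j v * T u v.

Lemma bilin_deltal (rho : nat -> I -> R) i j u :
  (forall v, rho i v = (v == u)%:R) -> bilin rho i j = \sum_w rho j w * T u w.
Proof.
move=> E; rewrite /bilin (bigD1 u) //= [X in _ + X]big1 ?addr0 => [|v vu].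
  by apply: eq_bigr => w _; rewrite E eqxx mul1r.
by rewrite big1 // => w _; rewrite E (negbTE vu) !mul0r.
Qed.

Lemma bilin_deltar (rho : nat -> I -> R) i j u :
  (forall v, rho j v = (v == u)%:R) -> bilin rho i j = \sum_w rho i w * T w u.
Proof.
move=> E; apply: eq_bigr => w _; rewrite (bigD1 u) //= big1 ?addr0 => [|v vu].
  by rewrite E eqxx mulr1.
by rewrite E (negbTE vu) mulr0 mul0r.
Qed.

(** Multilinearity is applied to one index at a time, until every row of W is an indicator function
    and the bilinear form reduces to T. *)
Lemma pf_aux_expand (W : nat -> I -> R) (u0 : I) m :
  pf_aux (bilin W) m (iota 1 m.*2) =
  \sum_(t : (m.*2).-tuple I)
    (\prod_(i < m.*2) W i.+1 (nth u0 t i)) *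
    pf_aux (fun i j => T (nth u0 t i.-1) (nth u0 t j.-1)) m (iota 1 m.*2).
Proof.
(* The rows already expanded are indicators of the chosen elements s. Rows are numbered from 1,
   hence the predecessor. *)
pose rho (s : seq I) i u :=
  if (i.-1 < size s)%N then (u == nth u0 s i.-1)%:R else W i u.
have main k s : (size s + k = m.*2)%N ->
  pf_aux (bilin (rho s)) m (iota 1 m.*2) =
  \sum_(t : k.-tuple I) (\prod_(i < k) W (size s + i).+1 (nth u0 t i)) *
    pf_aux (bilin (rho (s ++ t))) m (iota 1 m.*2).
  elim: k s => [|k IHk] s sk.
    rewrite (big_pred1 [tuple]) => [|t]; last by apply/esym/eqP/tuple0.
    by rewrite big_ord0 mul1r /= cats0.
  have rhoE j u w : (0 < j)%N -> j != (size s).+1 ->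
      rho s j w = rho (rcons s u) j w.
    case: j => // j _; rewrite eqSS => js.
    by rewrite /rho size_rcons ltnS nth_rcons /=; case: ltngtP js.
  have rhoI u v : rho (rcons s u) (size s).+1 v = (v == u)%:R.
    by rewrite /rho size_rcons ltnSn nth_rcons ltnn eqxx.
  rewrite (big_tuple_cons _ (fun t : seq I => (\prod_(i < k.+1) W (size s + i).+1 (nth u0 t i)) *
    pf_aux (bilin (rho (s ++ t))) m (iota 1 m.*2))).
  rewrite (pf_aux_linear (r := index_enum I) (c := W (size s).+1)
    (au := fun u => bilin (rho (rcons s u))) (i0 := (size s).+1)); first last.
  - move=> u i j; rewrite !mem_iota => /andP[i0 _] /andP[j0 _] si sj.
    by apply: eq_bigr => v _; apply: eq_bigr => w _; rewrite (rhoE i u) // (rhoE j u).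
  - move=> j; rewrite mem_iota => /andP[j0 _] sj.
    under [RHS]eq_bigr => u _.
      rewrite (@bilin_deltar (rho (rcons s u)) j _ u); last exact: rhoI.
      rewrite mulr_sumr; over.
    rewrite exchange_big; apply: eq_bigr => v _; apply: eq_bigr => w _ /=.
    by rewrite (rhoE j w) // {2}/rho ltnn; ring.
  - move=> j; rewrite mem_iota => /andP[j0 _] sj; apply: eq_bigr => u _.
    rewrite (@bilin_deltal (rho (rcons s u)) _ j u); last exact: rhoI.
    rewrite mulr_sumr; apply: eq_bigr => w _ /=.
    by rewrite (rhoE j u) // {1}/rho ltnn; ring.
  - by rewrite size_iota.
  - by rewrite mem_iota; lia.
  - exact: iota_uniq.
  apply: eq_bigr => u _; rewrite IHk ?size_rcons; last by rewrite addSnnS.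
  rewrite mulr_sumr; apply: eq_bigr => t _; rewrite cat_rcons mulrA.
  congr (_ * _); rewrite big_ord_recl addn0 /=; congr (_ * _).
  by apply: eq_bigr => i _; rewrite /bump /= addSn addnS.
have := main m.*2 [::] (add0n _); rewrite /= => E.
transitivity (pf_aux (bilin (rho [::])) m (iota 1 m.*2)).
  by apply: eq_pf_aux.
rewrite E; apply: eq_bigr => t _; congr (_ * _).
apply: eq_pf_aux => i j; rewrite !mem_iota => /andP[i0 iN] /andP[j0 jN].
rewrite (@bilin_deltal (rho t) i j (nth u0 t i.-1)) => [|v]; last first.
  by rewrite /rho size_tuple; case: ifP => //; lia.
rewrite (bigD1 (nth u0 t j.-1)) //= big1 ?addr0 => [|v vj].
  rewrite /rho size_tuple; case: ifP => [_|]; last by lia.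
  by rewrite eqxx mul1r.
rewrite /rho size_tuple; case: ifP => [_|]; last by lia.
by rewrite (negbTE vj) mul0r.
Qed.
End PfExpansion.

(** * Schur's Pfaffian *)

Section SchurPfaffian.
Variable F : fieldType.
Implicit Types (y : F) (l : seq F).

(** The first-row expansion of Schur's Pfaffian. For distinct entries it is [schurT_odd_sum]
    multiplied by [delta l]; repeated entries matter because the multilinear expansion runs over all
    tuples. *)
Lemma schurT_expand y l : odd (size l) ->
  (forall s t, s \in y :: l -> t \in y :: l -> s + t != 0) ->
  \sum_(p < size l) (-1) ^+ p * schurT y (nth 0 l p) * delta (rem_at p l) =
  \prod_(t <- l) schurT y t * delta l.
Proof.
move=> ol l0; have [ul|nul] := boolP (uniq l); last first.
  (* Only the terms removing one of two equal elements survive; they cancel. *)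
  rewrite (delta_dup nul) mulr0; have [l1 [x [l2 [l3 El]]]] := not_uniq_cat nul.
  have El' : l = (l1 ++ x :: l2) ++ x :: l3 by rewrite El -catA.
  have i1 : (size l1 < size l)%N by rewrite El size_cat /= -addSnnS leq_addr.
  have i2 : (size l1 + (size l2).+1 < size l)%N.
    by rewrite El' !size_cat /= -[X in (_ < X)%N]addSnnS leq_addr.
  have sz : (size l1 + (size l2).+1)%N = size (l1 ++ x :: l2) by rewrite size_cat.
  have R1 : rem_at (size l1) l = l1 ++ l2 ++ x :: l3 by rewrite El rem_at_cat.
  have N1 : nth 0 l (size l1) = x by rewrite El nth_cat ltnn subnn.
  have R2 : rem_at (size l1 + (size l2).+1) l = l1 ++ x :: l2 ++ l3.
    by rewrite sz El' rem_at_cat -catA.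
  have N2 : nth 0 l (size l1 + (size l2).+1) = x.
    by rewrite sz El' nth_cat ltnn subnn.
  rewrite (bigD1 (Ordinal i1)) // (bigD1 (Ordinal i2)) /=; last first.
    by rewrite -val_eqE /= -[X in _ != X]addn0 eqn_add2l.
  rewrite big1 ?addr0 => [|p /andP[p1 p2]]; last first.
    rewrite delta_dup ?mulr0 //.
    apply: (rem_at_dup (x0 := 0) (i := size l1) (j := size l1 + (size l2).+1)) => //.
    - by rewrite -addSnnS leq_addr.
    - by rewrite N1 N2.
  rewrite N1 N2 R1 R2.
  rewrite delta_move exprD exprS.
  have sq : (-1) ^+ size l2 * (-1) ^+ size l2 = 1 :> F.
    by rewrite -exprMn mulrNN mulr1 expr1n.
  by ring.
transitivity (\sum_(s <- l) schurT y s * (\prod_(t <- l | t != s) (schurT s t)^-1) * delta l);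
  last first.
  rewrite -mulr_suml schurT_odd_sum // => [s t sl tl|s sl].
    by apply: l0; rewrite inE ?sl ?tl orbT.
  by apply: l0; rewrite inE ?sl ?eqxx ?orbT.
rewrite (big_nth 0) big_mkord; apply: eq_bigr => p _.
rewrite (delta_nth (ltn_ord p)).
set s := nth 0 l p.
have sl : s \in l by rewrite mem_nth.
have -> : \prod_(t <- l | t != s) (schurT s t)^-1 = (\prod_(t <- rem_at p l) schurT s t)^-1.
  rewrite -prodfV (perm_big _ (perm_rem_at 0 (ltn_ord p))) -/s big_cons eqxx /=.
  rewrite big_seq_cond [RHS]big_seq; apply: eq_bigl => t.
  case: eqVneq => [->|_]; last by rewrite andbT.
  by rewrite andbF (negbTE (rem_at_notin _ _ _)).
have nz : \prod_(t <- rem_at p l) schurT s t != 0.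
  rewrite prodf_seq_neq0; apply/allP => t tp; apply/implyP => _.
  have tl := mem_rem_at tp.
  apply: mulf_neq0; last by rewrite invr_eq0 l0 // inE ?tl ?sl orbT.
  rewrite subr_eq0.
  by apply: contraTneq tp => ->; apply: rem_at_notin.
have sq : (-1) ^+ p * (-1) ^+ p = 1 :> F.
  by rewrite -exprMn mulrNN mulr1 expr1n.
by field.
Qed.

Lemma schur_pf m (idx : seq nat) (s : nat -> F) : size idx = m.*2 ->
  (forall i j, i \in idx -> j \in idx -> s i + s j != 0) ->
  pf_aux (fun i j => schurT (s i) (s j)) m idx = delta (map s idx).
Proof.
elim: m idx => [|m IHm] [|i l] //= [sl] H.
rewrite -schurT_expand ?size_map ?sl /= ?odd_double //; last first.
  rewrite -![s i :: _]/(map s (i :: l)).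
  by move=> u v /mapP[j jl ->] /mapP[k kl ->]; apply: H.
apply: eq_bigr => p _; rewrite -map_rem_at -(nth_map 0%N 0) ?sl //.
rewrite IHm ?size_rem_at ?sl // => j k /mem_rem_at jl /mem_rem_at kl.
by apply: H; rewrite inE ?jl ?kl orbT.
Qed.
End SchurPfaffian.

(** * Coefficients of H(u) *)

Section ConvSeq.
Variables (A : comNzRingType) (I : eqType) (g : I -> nat -> A).

(** Recursion on the list permits induction on the variables; [convol_ffun] identifies it with the
    sum over functions used in [h]. *)
Fixpoint convol (s : seq I) (q : nat) : A :=
  if s is y :: s' then \sum_(c < q.+1) g y c * convol s' (q - c)%N
  else (q == 0%N)%:R.

(** Here [fquot] is a truncation degree. Commutativity of the polynomial product then yields the
    symmetry [convol_perm]. *)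
Lemma convol_coef s fquot q : (q <= fquot)%N ->
  (\prod_(y <- s) \poly_(e < fquot.+1) g y e)`_q = convol s q.
Proof.
elim: s q => [|y s IHs] q qQ; first by rewrite big_nil coef1.
rewrite big_cons coefM; apply: eq_bigr => c _.
have cQ : (c <= fquot)%N by apply: leq_trans qQ; rewrite -ltnS.
by rewrite coef_poly ltnS cQ IHs // (leq_trans (leq_subr _ _)).
Qed.

Lemma convol_perm s s' : perm_eq s s' -> convol s =1 convol s'.
Proof.
by move=> ss' q; rewrite -!(@convol_coef _ q) // (perm_big _ ss').
Qed.
End ConvSeq.

Lemma convol_ffun (A : comNzRingType) (I : finType) (g : I -> nat -> A) q :
  \sum_(c : {ffun I -> 'I_q.+1} | (\sum_j (c j : nat) == q)%N)
    \prod_j g j (c j) = convol g (index_enum I) q.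
Proof.
rewrite -(@convol_coef _ _ _ _ q) //.
under eq_bigr do rewrite poly_def.
rewrite bigA_distr_bigA coef_sum /= big_mkcond; apply: eq_bigr => c _.
rewrite GRing.scaler_prod prodrXr coefZ coefXn eq_sym.
by case: ifP => _; rewrite ?mulr1 ?mulr0.
Qed.

Section FqSeq.
Variables (A : comNzRingType) (b : A).

Definition fqg (y : A) (q : nat) : A :=
  (1 + b * y) * ((1 + b * y) * y ^+ q + (0 < q)%N%:R * y ^+ q).
Definition hcoef := convol fqg.

Lemma fqg0 y : fqg y 0 = (1 + b * y) ^+ 2.
Proof. by rewrite /fqg ltnn mul0r addr0 mulr1. Qed.
Lemma fqgS y q : fqg y q.+1 = (1 + b * y) * ((1 + b * y) + 1) * y ^+ q.+1.
Proof. by rewrite /fqg ltn0Sn mul1r; ring. Qed.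

Lemma hcoef0 y s : hcoef (y :: s) 0 = (1 + b * y) ^+ 2 * hcoef s 0.
Proof. by rewrite /hcoef /= big_ord1 fqg0. Qed.

(** Coefficients in (u - y) H_(y::s)(u) = (1 + by)((1 + by)u + y) H_s(u), which is multiplication by
    (u (+) y)/(u (-) y) with the denominator cleared. *)
Lemma hcoefS y s q : hcoef (y :: s) q.+1 =
  y * hcoef (y :: s) q +
  (1 + b * y) * ((1 + b * y) * hcoef s q.+1 + y * hcoef s q).
Proof.
rewrite /hcoef /= 2!big_ord_recl [in RHS]big_ord_recl !subn0 /= subSS subn0.
rewrite mulrDr mulr_sumr.
have -> : \sum_(i < q) fqg y (bump 0 (lift ord0 i)) *
    convol fqg s (q.+1 - bump 0 (lift ord0 i)) =
  \sum_(i < q) y * (fqg y (bump 0 i) * convol fqg s (q - bump 0 i)).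
  apply: eq_bigr => i _.
  by rewrite /= /bump /= !add1n subSS !fqgS [y ^+ i.+2]exprS; ring.
rewrite fqg0 /bump /= addn0 fqgS expr1; ring.
Qed.
End FqSeq.
Arguments hcoef : simpl never.

Section HlResidue.
Variables (F : fieldType) (I : eqType) (b : F) (y : I -> F).
(** The constants come from (u (+) y_k)/(u (-) y_k) = ((1 + b y_k)^2 u + (1 + b y_k) y_k)/(u -
    y_k). *)
Definition hresidue := residue y (fun k => (1 + b * y k) ^+ 2)
                            (fun k => (1 + b * y k) * y k).

(** A pole r_p/(u - y_p), expanded in powers of y_p, contributes r_p y_p^q at u^(-q-1), and the
    coefficient of index 0 is the value at infinity. The recursion [hcoefS] propagates this from q
    to q+1. *)
Lemma hcoef_residue s : uniq s -> {in s &, injective y} ->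
  hcoef b (map y s) 0 = \prod_(k <- s) (1 + b * y k) ^+ 2 /\
  (forall q, hcoef b (map y s) q.+1 = \sum_(p <- s) hresidue s p * y p ^+ q).
Proof.
elim: s => [|z s IHs] /=.
  by move=> _ _; rewrite big_nil; split=> // q; rewrite big_nil.
move=> /andP[zs us] inj.
have [//|u v us' vs'|E0 ES] := IHs.
  by apply: inj; rewrite inE ?us' ?vs' orbT.
rewrite hcoef0 big_cons E0; split=> //.
have nz p : p \in s -> y p - y z != 0.
  move=> ps; rewrite subr_eq0; apply: contraNneq zs => /inj <- //.
    by rewrite inE ps orbT.
  by rewrite mem_head.
elim=> [|q IHq]; last first.
  rewrite hcoefS IHq !ES !big_cons mulrDr mulrCA -exprS -addrA; congr (_ + _).
  rewrite !mulr_sumr -!big_split /= mulr_sumr -big_split /=.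
  rewrite big_seq [RHS]big_seq; apply: eq_bigr => p ps.
  rewrite /hresidue residue_cons_notin; last by apply: contraNneq zs => <-.
  rewrite /lin !exprS; have := nz p ps; move=> ?; field; by [].
rewrite hcoefS hcoef0 E0 ES big_cons expr0 mulr1.
have -> : \sum_(p <- s) hresidue s p * y p ^+ 0 = \sum_(p <- s) hresidue s p.
  by apply: eq_bigr => p _; rewrite mulr1.
(* The residue at the new pole involves the old product at y_z, now expanded over the old poles. *)
rewrite {2}/hresidue residue_cons_head // partial_fractions //; first last.
- by move=> k ks; rewrite -subr_eq0 -opprB oppr_eq0 nz.
- by move=> u v us' vs'; apply: inj; rewrite inE ?us' ?vs' orbT.
set P := \prod_(k <- s) _.
set lz := lin _ _ z (y z).
transitivity (lz * P + (1 + b * y z) ^+ 2 * \sum_(p <- s) hresidue s p).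
  by rewrite /lz /lin; ring.
rewrite mulrDr -addrA; congr (_ + _); rewrite !mulr_sumr -big_split /=.
rewrite big_seq [RHS]big_seq; apply: eq_bigr => p ps.
rewrite mulr1 {2}/hresidue residue_cons_notin; last by apply: contraNneq zs => <-.
have h1 := nz p ps.
have h2 : y z - y p != 0 by rewrite -opprB oppr_eq0.
rewrite -/(hresidue s p) /lz /lin; field; by rewrite h1 h2.
Qed.
End HlResidue.

(** * Coefficients of (1 + B u)^e times a series in 1/u *)

Section CoefSeries.
Variables (R : idomainType) (B : series R).
Implicit Types (g h : nat -> series R) (e : int).

Definition coefz g (z : int) : series R := if z is Posz q then g q else 0.
Definition ord_seq g := forall q, ord_ge q (g q).

Definition cterm e (p : int) g (i : nat) : series R :=
  (gbinom e i)%:~R * B ^+ i * coefz g (i%:Z - p).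

(** [Cser] for an arbitrary coefficient sequence: the coefficient of u^p in (1 + B u)^e times the
    sum of g_q u^(-q). *)
Definition cser e (p : int) g : series R :=
  fun d => evlim 0 (fun N => (\sum_(k < N) cterm e p g k) d).

Lemma ord_coefz g k (z : int) : ord_seq g -> (k%:Z <= z)%R -> ord_ge k (coefz g z).
Proof.
by move=> Hg; case: z => [q|q] kz //=; apply: ord_geW (Hg q); lia.
Qed.

Lemma cser_sum e p g : ord_seq g -> is_sum (cterm e p g) (cser e p g).
Proof.
move=> Hg.
have [v Hv] : exists v, is_sum (cterm e p g) v.
  apply: (@is_sum_exists _ `|p|) => k; apply: ord_geMl.
  have [kp|kp] := ltnP k `|p|.
    by have -> : (k - `|p| = 0)%N by lia.
  by apply: ord_coefz => //; lia.
suff -> : cser e p g = v by [].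
apply: psP => d; have [N HN] := Hv d; exact: evlimE HN.
Qed.

Lemma cserE e p g v : ord_seq g -> is_sum (cterm e p g) v -> cser e p g = v.
Proof. by move=> Hg; apply: is_sum_unique; apply: cser_sum. Qed.

Lemma cser_pascal e p g : ord_seq g ->
  cser (e + 1) p g = cser e p g + B * cser e (p - 1) g.
Proof.
move=> Hg; apply: cserE => //.
have H2 : is_sum (fun i => if i is i'.+1 then B * cterm e (p - 1) g i' else 0)
                 (B * cser e (p - 1) g).
  rewrite -[B * _]add0r.
  apply: (@is_sum_shift _
    (fun i => if i is i'.+1 then B * cterm e (p - 1) g i' else 0)) => /=.
  by apply: is_sum_mull; apply: cser_sum.
apply: is_sum_ext (is_sumD (cser_sum e p Hg) H2) => -[|i].
  by rewrite /cterm !gbinom0 addr0.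
rewrite /cterm gbinom_pascal rmorphD.
have -> : i%:Z - (p - 1) = i.+1%:Z - p by lia.
by rewrite exprS; ring.
Qed.

(** The recursion [hcoefS] multiplied by (1 + B u)^e. Extended by zero to negative indices it still
    holds; at index -1 it is the condition on [h 0]. *)
Lemma cser_rec e p g h y : ord_seq g -> ord_seq h ->
  h 0%N = (1 + B * y) ^+ 2 * g 0%N ->
  (forall q, h q.+1 =
     y * h q + (1 + B * y) * ((1 + B * y) * g q.+1 + y * g q)) ->
  cser e (p - 1) h - y * cser e p h =
  (1 + B * y) * ((1 + B * y) * cser e (p - 1) g + y * cser e p g).
Proof.
move=> Hg Hh h0 hS.
have coefz_rec z : coefz h (z + 1) - y * coefz h z =
    (1 + B * y) * ((1 + B * y) * coefz g (z + 1) + y * coefz g z).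
  case: z => [q|[|q]] /=.
  - by rewrite addn1 hS; ring.
  - by rewrite h0; ring.
  by ring.
have Sh := cser_sum e (p - 1) Hh; have Sh' := cser_sum e p Hh.
have Sg := cser_sum e (p - 1) Hg; have Sg' := cser_sum e p Hg.
apply: (is_sum_unique (is_sumD Sh (is_sumN (is_sum_mull y Sh')))).
apply: is_sum_ext (is_sum_mull (1 + B * y)
  (is_sumD (is_sum_mull (1 + B * y) Sg) (is_sum_mull y Sg'))) => i.
rewrite /cterm; have -> : i%:Z - (p - 1) = (i%:Z - p) + 1 by lia.
transitivity ((gbinom e i)%:~R * B ^+ i *
   (coefz h (i%:Z - p + 1) - y * coefz h (i%:Z - p))); last by ring.
by rewrite coefz_rec; ring.
Qed.

(** Coefficient extraction as a residue: the pole at X_p contributes the value of u^a (1 + B u)^e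
    there. A strictly negative exponent keeps [g 0] out of the sum. *)
Lemma cser_power_sum (I : eqType) (s : seq I) (r X : I -> series R) e a g :
  ord_seq g -> (forall p, ord_ge 1 (X p)) ->
  (forall q, g q.+1 = \sum_(p <- s) r p * X p ^+ q) ->
  cser e (- (a.+1)%:Z) g = \sum_(p <- s) r p * X p ^+ a * (1 + B * X p) ^ e.
Proof.
move=> Hg HX gE; apply: cserE => //.
have H : is_sum (fun i => \sum_(p <- s) (r p * X p ^+ a) * bterm e (B * X p) i)
    (\sum_(p <- s) r p * X p ^+ a * (1 + B * X p) ^ e).
  apply: is_sum_sum => p _; apply: is_sum_mull; apply: is_sum_binomial.
  by apply: ord_geMl.
apply: is_sum_ext H => i; rewrite /cterm.
have -> : i%:Z - - a.+1%:Z = (i + a).+1%:Z by lia.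
rewrite /= gE mulr_sumr; apply: eq_bigr => p _.
by rewrite /bterm exprMn exprD; ring.
Qed.

Lemma ord_hcoef (ys : seq (series R)) : (forall y, y \in ys -> ord_ge 1 y) ->
  ord_seq (hcoef B ys).
Proof.
elim: ys => [|y ys IHys] H q; first by case: q => // q; apply: ord_ge_zero.
apply: ord_ge_sum => c _.
have qc : (q <= c + (q - c))%N by have := ltn_ord c; lia.
have Hy : ord_ge 1 y by apply: H; rewrite mem_head.
apply: (ord_geW qc); apply: ord_geM.
  apply: ord_geMl; apply: ord_geD; apply: ord_geMl; exact: ord_geX.
by apply: IHys => z zs; apply: H; rewrite inE zs orbT.
Qed.
End CoefSeries.

(** * The series GQ_(a,b) and the Pfaffian entries *)

Section GQ2Formula.
Variables (R : idomainType) (B : series R) (I : eqType) (X : I -> series R).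
Hypothesis HX : forall p, ord_ge 1 (X p).
Variables (s : seq I) (r : I -> series R) (r' : I -> I -> series R).
Hypothesis rE : forall q, hcoef B (map X s) q.+1 = \sum_(p <- s) r p * X p ^+ q.
Hypothesis r'E : forall p q, p \in s ->
  hcoef B (map X (rem p s)) q.+1 = \sum_(k <- rem p s) r' p k * X k ^+ q.

Notation H := (hcoef B (map X s)).
Definition gq2_term (a b : nat) (k : nat) : series R :=
  (-1) ^+ k *
  (cser B (-2) (- (a + k)%N%:Z) H * cser B (k%:Z - 1) (k%:Z - b%:Z) H -
   cser B (-2) (- (a + k).+1%:Z) H * cser B (k%:Z - 1) (k%:Z - b%:Z + 1) H).

Lemma ord_hcoefX (t : seq I) : ord_seq (hcoef B (map X t)).
Proof. by apply: ord_hcoef => y /mapP[p _ ->]. Qed.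

(* Removing x_p from H(u) cancels the factor u (+) x_p of the denominator, so *)
(* the sum over k collapses to its first term.                               *)
Lemma gq2_sum (a b : nat) :
  is_sum (gq2_term a.+1 b.+1)
    (\sum_(p <- s) \sum_(k <- rem p s) r p * r' p k * X p ^+ a * X k ^+ b *
       ((1 + B * X p) ^ (-1) * (1 + B * X k) ^ (-1))).
Proof.
pose g p := hcoef B (map X (rem p s)).
pose D p (k : nat) := cser B (k%:Z - 1) (k%:Z - b.+1%:Z) (g p).
have HU p : 1 + B * X p \is a GRing.unit by apply: unit_1D; apply: ord_geMl.
have Hg p : ord_seq (g p) by apply: ord_hcoefX.
have HH : ord_seq H by apply: ord_hcoefX.
(* This is the cancellation of u2 (+) x_p on coefficients. By Pascal's rule [D p k.+1] absorbs the
   term in B x_p, and the signs (-x_p)^k make the result telescope. *)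
have step p k : p \in s ->
  cser B (k%:Z - 1) (k%:Z - b.+1%:Z) H - X p * cser B (k%:Z - 1) (k%:Z - b.+1%:Z + 1) H
  = (1 + B * X p) * (D p k + X p * D p k.+1).
  move=> ps; have Hp : H =1 hcoef B (X p :: map X (rem p s)).
    apply: convol_perm; rewrite -[X p :: _]/(map X (p :: rem p s)).
    by apply: perm_map; apply: perm_to_rem.
  have := @cser_rec _ B (k%:Z - 1) (k%:Z - b.+1%:Z + 1) (g p) H (X p) (Hg p) HH.
  rewrite addrK => -> //; first last.
  - by move=> q; rewrite !Hp hcoefS.
  - by rewrite Hp hcoef0.
  congr (_ * _); rewrite /D.
  have -> : (k.+1%:Z - 1 : int) = (k%:Z - 1) + 1 by lia.
  have -> : (k.+1%:Z - b.+1%:Z : int) = k%:Z - b.+1%:Z + 1 by lia.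
  by rewrite cser_pascal // addrK; ring.
have D0 p : p \in s -> D p 0%N = \sum_(k <- rem p s) r' p k * X k ^+ b * (1 + B * X k) ^ (-1).
  move=> ps; rewrite /D.
  have -> : (0%:Z - 1 : int) = -1 by lia.
  have -> : (0%:Z - b.+1%:Z : int) = - b.+1%:Z by lia.
  by apply: cser_power_sum => // q; apply: r'E.
have -> : \sum_(p <- s) \sum_(k <- rem p s) r p * r' p k * X p ^+ a * X k ^+ b *
       ((1 + B * X p) ^ (-1) * (1 + B * X k) ^ (-1)) =
  \sum_(p <- s) (r p * X p ^+ a * (1 + B * X p) ^ (-2) * (1 + B * X p)) * D p 0%N.
  rewrite big_seq [RHS]big_seq; apply: eq_bigr => p ps.
  rewrite D0 // mulr_sumr; apply: eq_bigr => k _.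
  have -> : (1 + B * X p) ^ (-1) = (1 + B * X p) ^ (-2) * (1 + B * X p).
    by rewrite -{3}[1 + _]expr1z -exprzDr.
  by ring.
pose t p k := (r p * X p ^+ a * (1 + B * X p) ^ (-2) * (1 + B * X p)) *
   ((- X p) ^+ k * D p k - (- X p) ^+ k.+1 * D p k.+1).
have St : is_sum (fun k => \sum_(p <- s) t p k) (\sum_(p <- s)
    (r p * X p ^+ a * (1 + B * X p) ^ (-2) * (1 + B * X p)) * D p 0%N).
  apply: is_sum_sum => p _; apply: is_sum_mull.
  have -> : D p 0%N = (- X p) ^+ 0 * D p 0%N by rewrite mul1r.
  apply: (@is_sum_telescope _ (fun k => (- X p) ^+ k * D p k)) => k.
  by apply: ord_geMr; apply: ord_geX; apply: ord_geN.
apply: is_sum_ext St => k; rewrite /gq2_term addSn.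
rewrite !(@cser_power_sum _ _ _ s r X) //.
rewrite !mulr_suml -sumrB mulr_sumr big_seq [RHS]big_seq.
apply: eq_bigr => p ps; rewrite /t.
transitivity ((-1) ^+ k * (r p * X p ^+ (a + k) * (1 + B * X p) ^ (-2)) *
  (cser B (k%:Z - 1) (k%:Z - b.+1%:Z) H - X p * cser B (k%:Z - 1) (k%:Z - b.+1%:Z + 1) H)).
  by rewrite step // exprD -[- X p]mulN1r !exprMn !exprS; ring.
by rewrite exprS; ring.
Qed.
End GQ2Formula.

Section EntrySum.
Variables (R : idomainType) (B : series R) (I : eqType) (X : I -> series R).
Hypothesis HX : forall p, ord_ge 1 (X p).
Variables (s : seq I) (r : I -> series R) (r' : I -> I -> series R).

Definition gq2_val (a b : nat) : series R :=
  \sum_(p <- s) \sum_(k <- rem p s) r p * r' p k * X p ^+ a * X k ^+ b *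
       ((1 + B * X p) ^ (-1) * (1 + B * X k) ^ (-1)).

(** The inner sum over l in closed form; the sum over k remains, following the nesting of [sumS] in
    [entry]. *)
Definition entry_inner (e e' : int) (a b k : nat) : series R :=
  \sum_(p <- s) \sum_(q <- rem p s) (gbinom e k)%:~R * B ^+ k *
     (r p * r' p q * X p ^+ (a + k) * X q ^+ b *
       ((1 + B * X p) ^ (-1) * (1 + B * X q) ^ (e' - 1))).

Lemma entry_inner_sum (e e' : int) (a b k : nat) :
  is_sum (fun l => (gbinom e k * gbinom e' l)%:~R * B ^+ (k + l) *
                   gq2_val (a + k) (b + l))
         (entry_inner e e' a b k).
Proof.
have HB p : ord_ge 1 (B * X p) by apply: ord_geMl.
have H : is_sum (fun l => \sum_(p <- s) \sum_(q <- rem p s)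
    ((gbinom e k)%:~R * B ^+ k * (r p * r' p q * X p ^+ (a + k) * X q ^+ b *
       ((1 + B * X p) ^ (-1) * (1 + B * X q) ^ (-1)))) * bterm e' (B * X q) l)
    (\sum_(p <- s) \sum_(q <- rem p s)
    ((gbinom e k)%:~R * B ^+ k * (r p * r' p q * X p ^+ (a + k) * X q ^+ b *
       ((1 + B * X p) ^ (-1) * (1 + B * X q) ^ (-1)))) * (1 + B * X q) ^ e').
  apply: is_sum_sum => p _; apply: is_sum_sum => q _; apply: is_sum_mull.
  exact: is_sum_binomial.
have -> : entry_inner e e' a b k = \sum_(p <- s) \sum_(q <- rem p s)
    ((gbinom e k)%:~R * B ^+ k * (r p * r' p q * X p ^+ (a + k) * X q ^+ b *
       ((1 + B * X p) ^ (-1) * (1 + B * X q) ^ (-1)))) * (1 + B * X q) ^ e'.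
  apply: eq_bigr => p _; apply: eq_bigr => q _.
  by rewrite exprzDr ?unit_1D //; ring.
apply: is_sum_ext H => l; rewrite /gq2_val mulr_sumr; apply: eq_bigr => p _.
rewrite mulr_sumr; apply: eq_bigr => q _.
by rewrite /bterm rmorphM /= !exprD exprMn; ring.
Qed.

(** The binomial theorem: raising the exponent of x_p by k with weight binom(e,k) beta^k multiplies
    the summand by (1 + beta x_p)^e. *)
Lemma entry_outer_sum (e e' : int) (a b : nat) :
  is_sum (entry_inner e e' a b)
    (\sum_(p <- s) \sum_(q <- rem p s) r p * r' p q * X p ^+ a * X q ^+ b *
       ((1 + B * X p) ^ (e - 1) * (1 + B * X q) ^ (e' - 1))).
Proof.
have HB p : ord_ge 1 (B * X p) by apply: ord_geMl.
have H : is_sum (fun k => \sum_(p <- s) \sum_(q <- rem p s)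
    (r p * r' p q * X p ^+ a * X q ^+ b *
       ((1 + B * X p) ^ (-1) * (1 + B * X q) ^ (e' - 1))) * bterm e (B * X p) k)
    (\sum_(p <- s) \sum_(q <- rem p s)
    (r p * r' p q * X p ^+ a * X q ^+ b *
       ((1 + B * X p) ^ (-1) * (1 + B * X q) ^ (e' - 1))) * (1 + B * X p) ^ e).
  apply: is_sum_sum => p _; apply: is_sum_sum => q _; apply: is_sum_mull.
  exact: is_sum_binomial.
have -> : \sum_(p <- s) \sum_(q <- rem p s) r p * r' p q * X p ^+ a * X q ^+ b *
       ((1 + B * X p) ^ (e - 1) * (1 + B * X q) ^ (e' - 1)) =
  \sum_(p <- s) \sum_(q <- rem p s)
    (r p * r' p q * X p ^+ a * X q ^+ b *
       ((1 + B * X p) ^ (-1) * (1 + B * X q) ^ (e' - 1))) * (1 + B * X p) ^ e.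
  apply: eq_bigr => p _; apply: eq_bigr => q _.
  by rewrite (exprzDr _ e) ?unit_1D //; ring.
apply: is_sum_ext H => k; apply: eq_bigr => p _; apply: eq_bigr => q _.
by rewrite /bterm !exprD exprMn; ring.
Qed.
End EntrySum.

(** * The grading of MP n *)

Local Notation hcomp := Defs.comp.

Lemma compE n d (p : MP n.+1) :
  hcomp d p = \sum_(k < d.+1) (hcomp (d - k) p`_k)%:P * 'X^k :> {poly MP n}.
Proof. by []. Qed.

Lemma coef_comp n d (p : MP n.+1) k :
  (hcomp d p : {poly MP n})`_k = if (k <= d)%N then hcomp (d - k) p`_k else 0.
Proof.
rewrite compE coef_sum.
under eq_bigr do rewrite coefCM coefXn.
case: ifP => kd; last first.
  rewrite big1 // => i _; case: eqVneq => [E|_]; rewrite ?mulr0 //.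
  by move: kd; rewrite E -ltnS ltn_ord.
rewrite (bigD1 (Ordinal (n := d.+1) (m := k) kd)) //= eqxx mulr1 big1 ?addr0 // => i ik.
rewrite -val_eqE /= in ik; by rewrite eq_sym (negbTE ik) mulr0.
Qed.

Lemma comp_zmod n d : zmod_morphism (@hcomp n d).
Proof.
elim: n d => [|n IHn] d p q; first by rewrite /=; case: ifP; rewrite ?subr0.
apply/polyP => k; rewrite coefB !coef_comp coefB IHn.
by case: ifP; rewrite ?subr0.
Qed.
HB.instance Definition _ n d :=
  GRing.isZmodMorphism.Build (MP n) (MP n) (@hcomp n d) (@comp_zmod n d).

(** The substitution of t x_i for x_i, as a ring morphism into power series in t. *)
Definition homog n (p : MP n) : series (MP n) := polyS p.

Lemma homog_zmod n : zmod_morphism (@homog n).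
Proof. by move=> p q; apply: psP => d; rewrite /homog /polyS raddfB. Qed.
HB.instance Definition _ n :=
  GRing.isZmodMorphism.Build (MP n) (series (MP n)) (@homog n) (@homog_zmod n).

Lemma comp1 n d : hcomp d (1 : MP n) = (d == 0%N)%:R.
Proof.
elim: n d => [|n IHn] d; first by rewrite /=; case: ifP.
apply/polyP => k.
rewrite -[RHS]/((((d == 0%N)%:R : {poly MP n}))`_k) coefMn coef_comp !coef1.
case: k => [|k] /=; first by rewrite subn0 IHn.
by rewrite raddf0 if_same mul0rn.
Qed.

Lemma compM n d (p q : MP n) :
  hcomp d (p * q) = \sum_(i < d.+1) hcomp i p * hcomp (d - i) q.
Proof.
elim: n d p q => [|n IHn] d p q.
  rewrite /= big_ord_recl /= subn0; case: eqVneq => [->|d0].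
    by rewrite big_ord0 addr0.
  rewrite mulr0 add0r big1 // => i _; by rewrite mul0r.
apply/polyP => k; rewrite coef_comp coef_sum.
under [RHS]eq_bigr do rewrite coefM.
under [RHS]eq_bigr => i _ do under eq_bigr => l _ do rewrite !coef_comp.
rewrite exchange_big /=.
case: ifP => kd; last first.
  rewrite big1 // => l _; rewrite big1 // => i _.
  have lk := ltn_ord l; have id := ltn_ord i.
  case: ifP => li; rewrite ?mul0r //; case: ifP => kl; rewrite ?mulr0 //.
  by move: kd kl li lk id; lia.
rewrite coefM raddf_sum; apply: eq_bigr => l _ /=.
rewrite IHn.
have lk : (l <= k)%N by rewrite -ltnS.
have E1 : (d.+1 = l + (d - k).+1 + (k - l))%N by lia.
(* Only l <= i <= l + (d - k) contributes; outside this range one of the two components would have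
   negative degree. *)
pose f i := (if (l <= i)%N then hcomp (i - l) p`_l else 0) *
  (if (k - l <= d - i)%N then hcomp (d - i - (k - l)) q`_(k - l) else 0).
rewrite -[RHS](big_mkord xpredT f) (@big_cat_nat _ _ _ l) //=; last by lia.
rewrite [X in _ = X + _]big_nat [X in _ = X + _]big1 ?add0r => [|i /andP[_ il]]; last first.
  by rewrite /f leqNgt il mul0r.
rewrite (@big_cat_nat _ _ _ (l + (d - k).+1)) //=; [|lia|lia].
rewrite [X in _ = _ + X]big_nat [X in _ = _ + X]big1 ?addr0 => [|i /andP[i1 i2]]; last first.
  by rewrite /f; case: ifP => [|_]; case: ifP => //; rewrite ?mulr0 ?mul0r //; lia.
have -> : \sum_(l <= i < l + (d - k).+1) f i = \sum_(i < (d - k).+1) f (i + l)%N.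
  by rewrite -{1}[nat_of_ord l]add0n big_addn addKn big_mkord.
apply: eq_bigr => i _.
have id := ltn_ord i.
rewrite /f leq_addl addnK; case: ifP => [_|]; last by lia.
by congr (_ * hcomp _ _); lia.
Qed.

Lemma homog_monoid n : monoid_morphism (@homog n).
Proof.
split=> [|p q]; apply: psP => d; first by rewrite ps_1E -comp1.
exact: compM.
Qed.
HB.instance Definition _ n :=
  GRing.isMonoidMorphism.Build (MP n) (series (MP n)) (@homog n) (@homog_monoid n).

Lemma homog_beta n : homog (beta n) = ps_const (beta n).
Proof.
apply: psP => d; rewrite /homog /polyS /beta /ps_const.
elim: n d => [|n IHn] d; first by [].
apply/polyP => k; rewrite coef_comp [cst n.+1 'X]/= coefC.
case: k => [|k] /=; first by rewrite subn0 IHn; case: ifP; rewrite ?coef0 // coefC.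
by rewrite raddf0 if_same; case: ifP; rewrite ?coef0 ?coefC.
Qed.

Lemma homog_var n i : (i < n)%N -> homog (var n i) = ps_const (var n i) * ps_t _.
Proof.
move=> lin; apply: psP => d; rewrite ps_constM /ps_t /homog /polyS.
elim: n d lin => [|n IHn] d //; rewrite ltnS => lin.
apply/polyP => k; rewrite coef_comp /=.
rewrite mulr_natr coefMn; case: (eqVneq i n) => [_|ni].
  rewrite coefX; case: (eqVneq k 1%N) => [->|k1].
    rewrite comp1 -subn_eq0; case: d => [|[|d]] //=.
  rewrite raddf0 if_same mul0rn //.
rewrite coefC; case: k => [|k] /=; last by rewrite raddf0 if_same mul0rn.
rewrite subn0 IHn ?mulr_natr //; lia.
Qed.

(** Induction on the number of variables and on the Horner form in the last one, whose
    multiplication shifts components by one degree. *)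
Lemma comp_total n (p : MP n) :
  exists D, forall D', (D <= D')%N -> \sum_(d < D') hcomp d p = p.
Proof.
elim: n p => [|n IHn] p.
  exists 1%N => -[|D'] // _; rewrite big_ord_recl /= big1 ?addr0 //.
pose Xn : MP n.+1 := ('X : {poly MP n}).
have EX : homog Xn = ps_const Xn * ps_t _.
  have <- : var n.+1 n = Xn by rewrite /= eqxx.
  by apply: homog_var.
have step (q : MP n.+1) (c : MP n) :
  (exists D, forall D', (D <= D')%N -> \sum_(d < D') hcomp d q = q) ->
  exists D, forall D', (D <= D')%N ->
    \sum_(d < D') hcomp d (q * Xn + (c%:P : {poly MP n}) : MP n.+1) =
    q * Xn + (c%:P : {poly MP n}).
  case=> D HD; have [D2 HD2] := IHn c; exists (D + D2).+1 => -[|D'] // DD.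
  under eq_bigr do rewrite raddfD /=.
  rewrite big_split; congr (_ + _).
    transitivity (\sum_(d < D'.+1) hcomp d (q * Xn)); first by [].
    rewrite big_ord_recl.
    have E d : hcomp d (q * Xn) = if d is d'.+1 then Xn * hcomp d' q else 0.
      have : homog (q * Xn) d = (ps_const Xn * (ps_t _ * homog q)) d.
        transitivity ((homog q * homog Xn) d); first by rewrite -rmorphM.
        by rewrite EX mulrC mulrA.
      rewrite ps_constM ps_tM => E'; rewrite -[LHS]/(homog (q * Xn) d) E'.
      by case: d {E'} => [|d]; rewrite ?mulr0.
    rewrite [X in X + _]E add0r; under eq_bigr do rewrite E.
    by rewrite -mulr_sumr HD 1?mulrC //; lia.
  apply/polyP => k; rewrite coef_sum.
  under eq_bigr do rewrite coef_comp coefC.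
  rewrite coefC; case: k => [|k] /=.
    under eq_bigr do rewrite subn0.
    by apply: HD2; lia.
  by rewrite big1 // => i _; rewrite raddf0 if_same.
elim/poly_ind: p => [|p c Hp]; last exact: (step p c Hp).
by exists 0%N => D' _; rewrite big1 // => i _; rewrite raddf0.
Qed.

(** * The symmetrization sum *)

Section CosetReps.
Variables (n N : nat) (Nn : (N <= n)%N).

Definition coset_rep (w : 'S_n) : bool :=
  [forall i : 'I_n, forall j : 'I_n, ((N <= i) && (i < j))%N ==> (w i < w j)%N].

Definition head_tuple (w : 'S_n) : N.-tuple 'I_n :=
  [tuple w (widen_ord Nn i) | i < N].

Lemma uniq_head_tuple w : uniq (head_tuple w).
Proof.
rewrite /= map_inj_uniq ?enum_uniq // => i j /perm_inj /(congr1 val) /= ij.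
exact: val_inj.
Qed.

Lemma nth_head_tuple w u0 (i : 'I_n) : (i < N)%N -> nth u0 (head_tuple w) i = w i.
Proof.
move=> iN; rewrite -[i : nat]/(Ordinal iN : nat) -tnth_nth tnth_mktuple.
by congr (w _); apply: val_inj.
Qed.

(** The values beyond position N enumerate the complement of the head increasingly, so the head
    determines them. *)
Lemma coset_rep_inj w w' : coset_rep w -> coset_rep w' ->
  head_tuple w = head_tuple w' -> w = w'.
Proof.
move=> Cw Cw' E.
have agree (i : 'I_n) : (i < N)%N -> w i = w' i.
  by move=> iN; rewrite -!(nth_head_tuple _ i) // E.
pose tl (u : 'S_n) := [seq u i | i <- [seq i : 'I_n <- enum 'I_n | (N <= i)%N]].
have srt u : coset_rep u -> sorted (fun a b : 'I_n => (a < b)%N) (tl u).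
  move=> /forallP Cu; rewrite /tl sorted_map.
  have : sorted (fun a b : 'I_n => (a < b)%N) [seq i : 'I_n <- enum 'I_n | (N <= i)%N].
    apply: sorted_filter; first by move=> a b c; apply: ltn_trans.
    by have := iota_ltn_sorted 0 n; rewrite -val_enum_ord sorted_map.
  have : all (fun i : 'I_n => (N <= i)%N) [seq i : 'I_n <- enum 'I_n | (N <= i)%N].
    exact: filter_all.
  apply: sub_in_sorted => i j Ni Nj ij.
  have /forallP/(_ j)/implyP := Cu i; apply.
  by apply/andP; split; [exact: Ni | exact: ij].
have mem u v : (u \in tl v) = ((v^-1)%g u >= N)%N.
  apply/mapP/idP => [[i + ->]|H]; first by rewrite mem_filter permK => /andP[].
  by exists ((v^-1)%g u); rewrite ?permKV // mem_filter H mem_enum.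
have Etl : tl w = tl w'.
  apply: (irr_sorted_eq (leT := fun a b : 'I_n => (a < b)%N)).
  - by move=> a b c; apply: ltn_trans.
  - by move=> a; apply: ltnn.
  - exact: srt.
  - exact: srt.
  move=> u; rewrite !mem (leqNgt N) [in RHS](leqNgt N); congr (~~ _).
  apply/idP/idP => H.
    by rewrite -{1}(permKV w u) agree // permK.
  by rewrite -{1}(permKV w' u) -agree // permK.
apply/permP => i; have [iN|Ni] := ltnP i N; first exact: agree.
have /eq_in_map := Etl; apply; by rewrite mem_filter Ni mem_enum.
Qed.

Lemma coset_rep_exists (t : N.-tuple 'I_n) : uniq t ->
  exists2 w, coset_rep w & head_tuple w = t.
Proof.
move=> ut.
pose s := tval t ++ [seq k <- enum 'I_n | k \notin t].
have us : uniq s.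
  rewrite cat_uniq ut filter_uniq ?enum_uniq // andbT.
  by apply/hasPn => k; rewrite mem_filter => /andP[].
have ss : size s = n.
  rewrite -[RHS]card_ord cardE; apply: perm_size; apply: uniq_perm => //.
    exact: enum_uniq.
  by move=> k; rewrite mem_cat mem_filter !mem_enum andbT orbN.
pose f (i : 'I_n) : 'I_n := nth i s i.
have finj : injective f.
  move=> i j; rewrite /f (set_nth_default i) ?ss // => /eqP.
  by rewrite nth_uniq ?ss // => /eqP/val_inj.
exists (perm finj).
  apply/forallP => i; apply/forallP => j; apply/implyP => /andP[Ni ij].
  rewrite !permE /f !nth_cat size_tuple.
  have -> : (i < N)%N = false by lia.
  have -> : (j < N)%N = false by lia.
  pose l := [seq k <- enum 'I_n | k \notin t].
  have sz : (N + size l = n)%N by rewrite -[RHS]ss /s size_cat size_tuple.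
  have jn := ltn_ord j; have iN' := ltn_ord i.
  have Nj : (N <= j)%N by rewrite (leq_trans Ni) // ltnW.
  have jl : (j - N < size l)%N by rewrite ltn_subLR // sz.
  have il : (i - N < size l)%N by rewrite ltn_subLR // sz.
  rewrite -/l (set_nth_default i j) //.
  have sl : sorted (fun a b : 'I_n => (a < b)%N) l.
    apply: sorted_filter; first by move=> a b c; apply: ltn_trans.
    by have := iota_ltn_sorted 0 n; rewrite -val_enum_ord sorted_map.
  apply: (sorted_ltn_nth (leT := fun a b : 'I_n => (a < b)%N)) => //.
  - by move=> a b c; apply: ltn_trans.
  by rewrite ltn_sub2r // (leq_ltn_trans Ni).
apply: eq_from_tnth => i; rewrite tnth_mktuple permE /f /= nth_cat size_tuple ltn_ord.
by rewrite (tnth_nth (widen_ord Nn i)).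
Qed.

Lemma sum_coset_reps (R : nmodType) (G : N.-tuple 'I_n -> R) :
  (forall t : N.-tuple 'I_n, ~~ uniq t -> G t = 0) ->
  \sum_(t : N.-tuple 'I_n) G t = \sum_(w | coset_rep w) G (head_tuple w).
Proof.
move=> G0; rewrite (bigID (fun t : N.-tuple 'I_n => uniq t)) /=.
rewrite [X in _ + X]big1 ?addr0 //.
pose h (t : N.-tuple 'I_n) : 'S_n :=
  odflt 1%g [pick w | coset_rep w && (head_tuple w == t)].
have hP (t : N.-tuple 'I_n) : uniq t -> coset_rep (h t) /\ head_tuple (h t) = t.
  move=> ut; rewrite /h; case: pickP => [w /andP[? /eqP]//|/=] H.
  by have [w Cw E] := coset_rep_exists ut; have := H w; rewrite Cw E eqxx.
rewrite (reindex_onto head_tuple h) => [|t ut]; last by have [] := hP t ut.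
apply: eq_bigl => w; rewrite uniq_head_tuple /=.
have [C E] := hP _ (uniq_head_tuple w).
by apply/eqP/idP => [<-//|Cw]; apply: coset_rep_inj.
Qed.
End CosetReps.

(** * Terms of the expansion as terms of GQ_nu *)

Section DeltaBig.
Variable F : fieldType.

Lemma delta_big (l : seq F) :
  delta l = \prod_(i < size l) \prod_(j < size l | (i < j)%N) schurT l`_i l`_j.
Proof.
elim: l => [|y l IHl]; first by rewrite big_ord0.
rewrite /= big_ord_recl; congr (_ * _).
  rewrite [RHS]big_mkcond big_ord_recl /= mul1r (big_nth 0) big_mkord.
  by apply: eq_bigr.
rewrite IHl; apply: eq_bigr => i _.
rewrite [RHS]big_mkcond big_ord_recl /= mul1r [LHS]big_mkcond.
by apply: eq_bigr => j _; rewrite /= /bump /= !add1n ltnS.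
Qed.
End DeltaBig.

Section TermIdentity.
Variables (F : fieldType) (b : F) (n : nat) (y : 'I_n -> F).

Definition fplus (u v : F) := u + v + b * u * v.
Definition fminus (u v : F) := fplus u (- v / (1 + b * v)).
(** [GQterm] over an arbitrary field, so that it can be transported along field morphisms. *)
Definition fterm (nu : seq nat) (z : 'I_n -> F) : F :=
  \prod_(i < n | (i < size nu)%N)
     (fplus (z i) (z i) * z i ^+ (nth 0%N nu i).-1 *
      \prod_(j < n | (i < j)%N) (fplus (z i) (z j) / fminus (z i) (z j))).

Hypothesis y_inj : injective y.
Hypothesis yU : forall p, 1 + b * y p != 0.
Hypothesis yD : forall p q, fplus (y p) (y q) != 0.
Hypothesis y2 : forall p, 2 + b * y p != 0.
Hypothesis F2 : (2 : F) != 0.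

(* In this coordinate the kernel (z - y)/(y (+) z) takes Schur's form. *)
Definition scoord p := y p / (2 + b * y p).

Lemma schurTE p q : schurT (scoord p) (scoord q) = (y q - y p) / fplus (y p) (y q).
Proof.
have : fplus (y p) (y q) != 0 := yD p q.
rewrite /schurT /scoord /fplus => D; have := y2 p; have := y2 q => q2 p2.
have E1 : y q / (2 + b * y q) - y p / (2 + b * y p) =
  2 * (y q - y p) / ((2 + b * y p) * (2 + b * y q)) by field; rewrite q2 p2.
have E2 : y q / (2 + b * y q) + y p / (2 + b * y p) =
  2 * (y p + y q + b * y p * y q) / ((2 + b * y p) * (2 + b * y q)).
  by field; rewrite q2 p2.
rewrite E1 E2; field; by rewrite F2 q2 p2 D.
Qed.

Lemma scoord_add_neq0 p q : scoord p + scoord q != 0.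
Proof.
have -> : scoord p + scoord q = 2 * fplus (y p) (y q) / ((2 + b * y p) * (2 + b * y q)).
  by rewrite /scoord /fplus; field; rewrite !y2.
by rewrite !mulf_neq0 ?invr_eq0 ?mulf_neq0.
Qed.

Lemma sub_y_neq0 p q : p != q -> y p - y q != 0.
Proof. by move=> pq; rewrite subr_eq0; apply: contraNneq pq => /y_inj ->. Qed.

Lemma quotE p q : p != q -> fplus (y p) (y q) / fminus (y p) (y q) =
  (1 + b * y q) * fplus (y p) (y q) / (y p - y q).
Proof.
move=> pq; have h := sub_y_neq0 pq; have u := yU q.
have -> : fminus (y p) (y q) = (y p - y q) / (1 + b * y q).
  by rewrite /fminus /fplus; field.
by field; rewrite h u.
Qed.

Definition pf_weight (nu : seq nat) (i : nat) (p : 'I_n) : F :=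
  hresidue b y (index_enum 'I_n) p * y p ^+ (nuAt nu i).-1 *
  (1 + b * y p) ^ (i%:Z - (size nu)%:Z - 1).

Definition fquot p q := fplus (y p) (y q) / fminus (y p) (y q).

Lemma hresidueE p : hresidue b y (index_enum 'I_n) p =
  (1 + b * y p) * fplus (y p) (y p) * \prod_(k < n | k != p) fquot p k.
Proof.
rewrite /hresidue /residue /lin; congr (_ * _); first by rewrite /fplus; ring.
apply: eq_bigr => k kp; rewrite /fquot quotE 1?eq_sym //.
by rewrite /fplus; congr (_ / _); ring.
Qed.

Lemma quot_schurT p q : p != q -> fquot q p * schurT (scoord p) (scoord q) = 1 + b * y p.
Proof.
move=> pq; rewrite /fquot quotE 1?eq_sym // schurTE.
have h : y q - y p != 0 by apply: sub_y_neq0; rewrite eq_sym.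
have d := yD p q; have -> : fplus (y q) (y p) = fplus (y p) (y q).
  by rewrite /fplus; ring.
by field; rewrite h d.
Qed.

Lemma delta_big_widen N (Nn : (N <= n)%N) (G : nat -> nat -> F) :
  \prod_(i < N) \prod_(j < N | (i < j)%N) G i j =
  \prod_(i < n | (i < N)%N) \prod_(j < n | (i < j)%N && (j < N)%N) G i j.
Proof.
rewrite (big_ord_widen _ (fun i => \prod_(j < N | (i < j)%N) G i j) Nn).
by apply: eq_bigr => i _; rewrite (big_ord_widen_cond _ _ _ Nn).
Qed.

(** The quotients of w(i) against later positions ([up]) belong to the GQ term. Those against
    earlier positions ([dn]) meet Schur's factors, and by [quot_schurT] each such pair leaves 1 + b
    y at its earlier position; the powers [e i] cancel these. *)
Lemma fterm_head_tuple (nu : seq nat) (Nn : (size nu <= n)%N) (w : 'S_n) (u0 : 'I_n) :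
  \prod_(i < size nu) pf_weight nu i.+1 (nth u0 (head_tuple Nn w) i) *
    delta (map scoord (head_tuple Nn w)) =
  fterm nu (fun i => y (w i)).
Proof.
set N := size nu in Nn *.
rewrite (big_ord_widen _ (fun i => pf_weight nu i.+1 (nth u0 (head_tuple Nn w) i)) Nn).
have -> : delta (map scoord (head_tuple Nn w)) = \prod_(i < n | (i < N)%N)
    \prod_(j < n | (i < j)%N && (j < N)%N) schurT (scoord (w i)) (scoord (w j)).
  rewrite delta_big size_map size_tuple (delta_big_widen Nn
    (fun i j => schurT (map scoord (head_tuple Nn w))`_i (map scoord (head_tuple Nn w))`_j)).
  apply: eq_bigr => i iN; apply: eq_bigr => j /andP[_ jN].
  by rewrite !(nth_map u0) ?size_tuple // !nth_head_tuple.
rewrite -big_split /=.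
pose U i := 1 + b * y (w i).
pose A (i : 'I_n) := fplus (y (w i)) (y (w i)) * y (w i) ^+ (nth 0%N nu i).-1.
pose up (i : 'I_n) := \prod_(j < n | (i < j)%N) fquot (w i) (w j).
pose dn (i : 'I_n) := \prod_(j < n | (j < i)%N) fquot (w i) (w j).
pose TT (i : 'I_n) := \prod_(j < n | (i < j)%N && (j < N)%N) schurT (scoord (w i)) (scoord (w j)).
pose e (i : 'I_n) : int := i.+1%:Z - N%:Z.
have step (i : 'I_n) : (i < N)%N -> pf_weight nu i.+1 (nth u0 (head_tuple Nn w) i) =
    A i * up i * (U i ^ e i * dn i).
  move=> iN; rewrite nth_head_tuple // /pf_weight hresidueE /nuAt /=.
  have -> : \prod_(k < n | k != w i) fquot (w i) k = up i * dn i.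
    rewrite (reindex_inj (@perm_inj _ w)) /=.
    rewrite (bigID (fun j : 'I_n => (i < j)%N)) /=; congr (_ * _); apply: eq_bigl => j.
      by rewrite (inj_eq perm_inj) -val_eqE neq_ltn; case: ltngtP.
    by rewrite (inj_eq perm_inj) -val_eqE neq_ltn; case: ltngtP.
  have -> : U i ^ e i = U i * U i ^ (i.+1%:Z - N%:Z - 1).
    rewrite -{2}[U i]expr1z -expfzDr ?yU //; congr (_ ^ _); rewrite /e; lia.
  by rewrite /A /U -/N; ring.
transitivity (\prod_(i < n | (i < N)%N) ((A i * up i) * (U i ^ e i * dn i * TT i))).
  by apply: eq_bigr => i iN; rewrite step // !mulrA.
rewrite big_split /= [X in _ * X](_ : _ = 1) ?mulr1 //.
(* The quotients are regrouped by the earlier of their two positions, where the matching Schur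
   factor sits. *)
rewrite !big_split /= /dn (exchange_big_dep (fun j : 'I_n => (j < N)%N)) /=; last first.
  by move=> i j iN ji; apply: ltn_trans iN.
rewrite -!big_split big1 //= => i iN.
rewrite -mulrA /TT.
have -> : \prod_(j < n | (j < N)%N && (i < j)%N) fquot (w j) (w i) =
  \prod_(j < n | (i < j)%N && (j < N)%N) fquot (w j) (w i).
  by apply: eq_bigl => j; rewrite andbC.
rewrite -big_split /=.
have -> : \prod_(j < n | (i < j)%N && (j < N)%N)
    (fquot (w j) (w i) * schurT (scoord (w i)) (scoord (w j))) =
  \prod_(j < n | (i < j)%N && (j < N)%N) U i.
  apply: eq_bigr => j /andP[ij _]; rewrite quot_schurT // (inj_eq perm_inj).
  by rewrite -val_eqE neq_ltn ij.
rewrite -(big_ord_widen_cond _ (fun j => (i < j)%N) (fun=> U i) Nn).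
have -> : \prod_(j < N | (i < j)%N) U i = U i ^+ (N - i.+1).
  by rewrite -(big_geq_mkord i.+1 N xpredT (fun=> U i)) prodr_const_nat.
rewrite -[U i ^+ _]/(U i ^ (N - i.+1)%N%:Z) -expfzDr ?yU //.
have -> : e i + (N - i.+1)%N%:Z = 0 by rewrite /e; lia.
by rewrite expr0z.
Qed.
End TermIdentity.

(** * The Pfaffian as a symmetrization sum *)

Section PfSum.
Variables (F : fieldType) (b : F) (n : nat) (y : 'I_n -> F).
Hypothesis y_inj : injective y.
Hypothesis yU : forall p, 1 + b * y p != 0.
Hypothesis yD : forall p q, fplus b (y p) (y q) != 0.
Hypothesis y2 : forall p, 2 + b * y p != 0.
Hypothesis F2 : (2 : F) != 0.
Variables (nu : seq nat) (m : nat).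
Hypothesis Hsize : size nu = m.*2.

Definition pf_kernel p q := schurT (scoord b y p) (scoord b y q).

(** Deleting y_p multiplies the residue at y_q by T_pq/(1 + b y_p). This lowers the exponent at p by
    one, so rows and columns carry the same weight; the diagonal may be added since T_pp = 0. *)
Lemma entry_bilin i j (s := index_enum 'I_n) :
  \sum_(p <- s) \sum_(q <- rem p s) hresidue b y s p * hresidue b y (rem p s) q *
     y p ^+ (nuAt nu i).-1 * y q ^+ (nuAt nu j).-1 *
     ((1 + b * y p) ^ (i.+1%:Z - (2 * m)%N%:Z - 1) *
      (1 + b * y q) ^ (j%:Z - (2 * m)%N%:Z - 1)) =
  bilin pf_kernel (pf_weight b y nu) i j.
Proof.
rewrite /bilin; apply: eq_bigr => p _.
have us : uniq s by apply: index_enum_uniq.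
have ps : p \in s by apply: mem_index_enum.
rewrite (bigD1 p) //= {1}/pf_kernel schurTxx mulr0 add0r.
rewrite rem_filter // big_filter; apply: eq_bigr => q qp.
rewrite /pf_weight -/s Hsize.
have -> : hresidue b y s q = hresidue b y [seq x <- s | predC1 p x] q *
   ((1 + b * y p) * fplus b (y q) (y p) / (y q - y p)).
  transitivity (hresidue b y (p :: rem p s) q).
    by rewrite /hresidue /residue (perm_big _ (perm_to_rem ps)).
  rewrite /hresidue residue_cons_notin // rem_filter //; congr (_ * (_ / _)).
  by rewrite /lin /fplus; ring.
rewrite /pf_kernel schurTE //.
have h : y q - y p != 0 by apply: sub_y_neq0.
have d := yD p q; have -> : fplus b (y q) (y p) = fplus b (y p) (y q).
  by rewrite /fplus; ring.
have -> : (1 + b * y p) ^ (i.+1%:Z - (2 * m)%N%:Z - 1) =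
  (1 + b * y p) * (1 + b * y p) ^ (i%:Z - m.*2%:Z - 1).
  rewrite -{2}[1 + b * y p]expr1z -expfzDr //; congr (_ ^ _).
  by rewrite mul2n; lia.
rewrite mul2n; set A := _ ^ _; set C := _ ^ _.
by field; rewrite h d.
Qed.
Hypothesis Nn : (size nu <= n)%N.

Lemma pf_fterm_sum (u0 : 'I_n) :
  pf_aux (bilin pf_kernel (pf_weight b y nu)) m (iota 1 m.*2) =
  \sum_(w | coset_rep (size nu) w) fterm b nu (fun i => y (w i)).
Proof.
pose G (t : (size nu).-tuple 'I_n) :=
  \prod_(i < size nu) pf_weight b y nu i.+1 (nth u0 t i) * delta (map (scoord b y) t).
under [RHS]eq_bigr do rewrite -(fterm_head_tuple y_inj yU yD y2 F2 Nn _ u0).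
rewrite -[RHS](sum_coset_reps Nn (G := G)); last first.
  move=> t nut; rewrite /G delta_dup ?mulr0 //.
  by apply: contra nut; apply: map_uniq.
rewrite {}/G; move: Nn; rewrite Hsize => _; rewrite (pf_aux_expand _ _ u0).
apply: eq_bigr => t _; congr (_ * _).
rewrite (@schur_pf _ m (iota 1 m.*2) (fun i => scoord b y (nth u0 t i.-1))); first last.
- by move=> i j _ _; apply: scoord_add_neq0.
- by rewrite size_iota.
congr (delta _); apply: (@eq_from_nth _ 0); first by rewrite !size_map size_iota size_tuple.
move=> i; rewrite size_map size_iota => iN.
by rewrite (nth_map 0%N) ?size_iota // (nth_map u0) ?size_tuple // nth_iota.
Qed.

End PfSum.

(** * Extension of an injective morphism to the field of fractions *)

Section FractionExtension.
Variables (R : idomainType) (L : fieldType) (phi : {rmorphism R -> L}).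
Hypothesis phi_inj : injective phi.
Local Notation tof := (@FracField.tofrac R).

Lemma fraction_repr (x : {fraction R}) :
  exists nd : R * R, nd.2 != 0 /\ x * tof nd.2 = tof nd.1.
Proof.
elim/quotW: x => r; exists (frac r); split; first exact: denom_ratioP.
unlock FracField.tofrac; rewrite -[LHS]FracField.pi_mul; apply/eqmodP => /=.
rewrite FracField.equivfE /FracField.mulf.
by rewrite !numden_Ratio ?mulf_neq0 ?oner_neq0 ?denom_ratioP // !mulr1 mulrC.
Qed.

Definition frac_ext (x : {fraction R}) : L :=
  let nd := proj1_sig (boolp.cid (fraction_repr x)) in phi nd.1 / phi nd.2.

Lemma frac_extE x a d : d != 0 -> x * tof d = tof a -> frac_ext x = phi a / phi d.
Proof.
rewrite /frac_ext; case: boolp.cid => -[a' d'] /= [d'0 E'] d0 E.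
have pd0 u : u != 0 -> phi u != 0 by rewrite -(rmorph0 phi) (inj_eq phi_inj).
apply/eqP; rewrite eqr_div ?pd0 // -!rmorphM (inj_eq phi_inj) -tofrac_eq !tofracM.
by rewrite -E -E'; apply/eqP; ring.
Qed.

Lemma frac_ext_tofrac a : frac_ext (tof a) = phi a.
Proof.
rewrite (@frac_extE _ a 1) ?oner_neq0 ?rmorph1 ?divr1 //.
by rewrite mulr1.
Qed.

Lemma frac_ext_zmod : zmod_morphism frac_ext.
Proof.
move=> x y; have [[a d] /= [d0 E]] := fraction_repr x.
have [[a' d'] /= [d'0 E']] := fraction_repr y.
rewrite (frac_extE d0 E) (frac_extE d'0 E').
rewrite (@frac_extE _ (a * d' - a' * d) (d * d')) ?mulf_neq0 //.
  have pd0 u : u != 0 -> phi u != 0 by rewrite -(rmorph0 phi) (inj_eq phi_inj).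
  by rewrite rmorphB !rmorphM; field; rewrite !pd0.
by rewrite tofracB !tofracM -E -E'; ring.
Qed.
Lemma frac_ext_monoid : monoid_morphism frac_ext.
Proof.
split=> [|x y]; first by rewrite -[X in frac_ext X]tofrac1 frac_ext_tofrac rmorph1.
have [[a d] /= [d0 E]] := fraction_repr x.
have [[a' d'] /= [d'0 E']] := fraction_repr y.
rewrite (frac_extE d0 E) (frac_extE d'0 E').
rewrite (@frac_extE _ (a * a') (d * d')) ?mulf_neq0 //.
  by rewrite !rmorphM invfM; ring.
by rewrite !tofracM -E -E'; ring.
Qed.
End FractionExtension.

(** * Power series over the field of fractions *)

Lemma convol_map (A : comNzRingType) (I J : eqType) (g : J -> nat -> A) (f : I -> J) s q :
  convol g (map f s) q = convol (fun i => g (f i)) s q.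
Proof.
by elim: s q => //= i s IHs q; apply: eq_bigr => c _; rewrite IHs.
Qed.

Lemma hcoef_rmorph (A A' : comNzRingType) (phi : {rmorphism A -> A'}) b ys q :
  phi (hcoef b ys q) = hcoef (phi b) (map phi ys) q.
Proof.
rewrite /hcoef; elim: ys q => [|y ys IHys] q /=; first by rewrite rmorph_nat.
rewrite rmorph_sum; apply: eq_bigr => c _; rewrite rmorphM IHys; congr (_ * _).
by rewrite /fqg !(rmorphM, rmorphD, rmorph1, rmorphXn, rmorph_nat).
Qed.

Lemma h_hcoef n q : h n q = hcoef (beta n) (map (fun i : 'I_n => var n i) (index_enum 'I_n)) q.
Proof. by rewrite /hcoef convol_map -convol_ffun. Qed.

Section Iota.
Variable n : nat.
Local Notation K := {fraction MP n}.
Local Notation tofr := (@FracField.tofrac (MP n)).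

Definition iota_ser (f : Ser n) : series K := ps_map tofr f.
Definition theta (p : MP n) : series K := ps_map tofr (homog p).
HB.instance Definition _ := GRing.RMorphism.copy theta (ps_map tofr \o @homog n).

Definition xs (i : 'I_n) : series K := ps_const (xf i) * ps_t K.
Definition bs : series K := ps_const (betaF n).

Lemma ps_map_const c : ps_map tofr (ps_const c) = ps_const (tofr c).
Proof. by apply: psP => d; rewrite /ps_map /ps_const; case: ifP; rewrite ?tofrac0. Qed.
Lemma ps_map_t : ps_map tofr (ps_t (MP n)) = ps_t K.
Proof. by apply: psP => d; rewrite /ps_map /ps_t rmorph_nat. Qed.

Lemma thetaM p q : theta (p * q) = theta p * theta q. Proof. exact: rmorphM. Qed.
Lemma thetaX p k : theta (p ^+ k) = theta p ^+ k. Proof. exact: rmorphXn. Qed.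
Lemma theta_int c : theta c%:~R = c%:~R. Proof. exact: rmorph_int. Qed.

Lemma theta_var (i : 'I_n) : theta (var n i) = xs i.
Proof. by rewrite /theta homog_var // rmorphM /= ps_map_const ps_map_t. Qed.
Lemma theta_beta : theta (beta n) = bs.
Proof. by rewrite /theta homog_beta ps_map_const. Qed.

Lemma const_beta (c : int) q :
  ps_const (tofr (c%:~R * beta n ^+ q)) = c%:~R * bs ^+ q.
Proof.
have tof_int : tofr c%:~R = c%:~R by exact: rmorph_int.
have const_int : ps_const (c%:~R : K) = c%:~R by exact: rmorph_int.
rewrite tofracM tofracXn tof_int -const_int /bs.
transitivity (ps_const (c%:~R : K) * ps_const (tofr (beta n) ^+ q)).
  exact: rmorphM.
by congr (_ * _); apply: rmorphXn.
Qed.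

Lemma iota_scaleS c f : iota_ser (scaleS c f) = ps_const (tofr c) * iota_ser f.
Proof. by apply: psP => d; rewrite ps_constM /iota_ser /ps_map /scaleS rmorphM. Qed.
Lemma iota_subS f g : iota_ser (subS f g) = iota_ser f - iota_ser g.
Proof. by apply: psP => d; rewrite /iota_ser /ps_map /subS rmorphB. Qed.
Lemma iota_mulS f g : iota_ser (mulS f g) = iota_ser f * iota_ser g.
Proof. exact: (rmorphM (ps_map tofr)). Qed.
Lemma iota_inj : injective iota_ser.
Proof.
move=> f g E; apply: boolp.funext => d.
by have /(congr1 (fun u => u d)) := E; rewrite /iota_ser /ps_map => /eqP;
  rewrite tofrac_eq => /eqP.
Qed.

(** As the embedding into fractions is injective, eventual constancy over K gives it over [MP n],
    where [sumS] takes its limit. *)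
Lemma iota_sumS (F : nat -> Ser n) v :
  is_sum (fun k => iota_ser (F k)) v -> iota_ser (sumS F) = v.
Proof.
move=> H; apply: psP => d; have [N HN] := H d.
have E M : (N <= M)%N -> tofr (\sum_(k < M) F k d) = v d.
  by move=> NM; rewrite -(HN M NM) ps_sumE rmorph_sum.
rewrite -(E N) //; congr (tofr _); apply: (@evlimE _ _ _ N) => M NM.
by apply/eqP; rewrite -tofrac_eq; apply/eqP; rewrite !E.
Qed.

Local Notation s := (index_enum 'I_n).
Local Notation H := (hcoef bs (map xs s)).

Lemma theta_h q : theta (h n q) = H q.
Proof.
transitivity (hcoef (theta (beta n))
    (map theta (map (fun i : 'I_n => var n i) s)) q).
  by rewrite h_hcoef; apply: hcoef_rmorph.
rewrite theta_beta; congr (hcoef _ _ _).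
by rewrite -map_comp; apply: eq_map => i; apply: theta_var.
Qed.

Lemma ord_xs p : ord_ge 1 (xs p).
Proof.
move=> d; rewrite ltnS leqn0 => /eqP->.
by rewrite /xs ps_constM /ps_t mulr0.
Qed.

Lemma iota_Cser e p : iota_ser (Cser n e p) = cser bs e p H.
Proof.
apply: iota_sumS.
have OH : ord_seq H by apply: ord_hcoefX; apply: ord_xs.
apply: is_sum_ext (cser_sum bs e p OH) => i.
rewrite -[RHS]/(theta _) !thetaM thetaX theta_int theta_beta /cterm.
congr (_ * _); case: (i%:Z - p) => q; first by rewrite /= theta_h.
by rewrite rmorph0.
Qed.

Variables (r : 'I_n -> series K) (r' : 'I_n -> 'I_n -> series K).
Hypothesis rE : forall q, H q.+1 = \sum_(p <- s) r p * xs p ^+ q.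
Hypothesis r'E : forall p q, p \in s ->
  hcoef bs (map xs (rem p s)) q.+1 = \sum_(k <- rem p s) r' p k * xs k ^+ q.

(** The residues r and r' enter only through their power sums; [residue_series] later supplies
    them. *)
Lemma iota_GQ2 a b : (0 < a)%N -> (0 < b)%N ->
  iota_ser (GQ2 n a b) = gq2_val bs xs s r r' a.-1 b.-1.
Proof.
case: a b => [//|a] [//|b] _ _; apply: iota_sumS.
apply: is_sum_ext (gq2_sum ord_xs rE r'E a b) => k.
rewrite iota_scaleS iota_subS !iota_mulS !iota_Cser /gq2_term; congr (_ * _).
by rewrite !rmorphXn !rmorphN1.
Qed.

Lemma iota_entry m nu i j : (0 < nuAt nu i)%N -> (0 < nuAt nu j)%N ->
  iota_ser (entry n m nu i j) =
  \sum_(p <- s) \sum_(q <- rem p s) r p * r' p q *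
     xs p ^+ (nuAt nu i).-1 * xs q ^+ (nuAt nu j).-1 *
     ((1 + bs * xs p) ^ (i.+1%:Z - (2 * m)%N%:Z - 1) *
      (1 + bs * xs q) ^ (j%:Z - (2 * m)%N%:Z - 1)).
Proof.
move=> i0 j0; apply: iota_sumS.
apply: is_sum_ext (entry_outer_sum bs ord_xs s r r' _ _ _ _) => k.
symmetry; apply: iota_sumS.
apply: is_sum_ext (entry_inner_sum bs ord_xs s r r' _ _ _ _ _) => l.
rewrite iota_scaleS iota_GQ2 ?ltn_addr //.
have -> : (nuAt nu i + k).-1 = ((nuAt nu i).-1 + k)%N by lia.
have -> : (nuAt nu j + l).-1 = ((nuAt nu j).-1 + l)%N by lia.
congr (_ * _); rewrite const_beta //.
Qed.
End Iota.

Section PfTrunc.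
Variable R : idomainType.
(** Sums and products respect agreement up to degree d, so the truncated Pfaffian of [PfS] is that
    of the ring of power series. *)
Lemma pf_trunc (A : nat -> nat -> series R) m l d e : (e <= d)%N ->
  (pf_aux (fun i j => \poly_(k < d.+1) A i j k) m l)`_e = pf_aux A m l e.
Proof.
have mulE (p q : {poly R}) (f g : series R) :
    (forall e, (e <= d)%N -> p`_e = f e) -> (forall e, (e <= d)%N -> q`_e = g e) ->
    forall e, (e <= d)%N -> (p * q)`_e = (f * g) e.
  move=> Hp Hq c cd; rewrite coefM ps_mulE; apply: eq_bigr => i _.
  have ic : (i <= c)%N by rewrite -ltnS.
  by rewrite Hp ?Hq // ?(leq_trans (leq_subr _ _)) // (leq_trans ic).
have sgnE k : forall e, (e <= d)%N -> ((-1) ^+ k : {poly R})`_e = ((-1) ^+ k : series R) e.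
  move=> c cd; rewrite -signr_odd -[in RHS]signr_odd; case: (odd k).
    by rewrite !expr1 coefN coef1 ps_oppE ps_1E.
  by rewrite !expr0 coef1 ps_1E.
elim: m l e => [|m IHm] [|i l] e ed /=.
- by rewrite coef1 ps_1E.
- by rewrite coef1 ps_1E.
- by rewrite coef0 ps_0E.
rewrite coef_sum ps_sumE; apply: eq_bigr => p _.
apply: (mulE) => //; last by move=> c cd; apply: IHm.
apply: (mulE) => // c cd; first exact: sgnE.
by rewrite coef_poly ltnS cd.
Qed.
End PfTrunc.

Lemma PfS_pf n m (A : nat -> nat -> Ser n) :
  PfS m A = Pf m (A : nat -> nat -> series (MP n)).
Proof. by apply: boolp.funext => d; rewrite /PfS /Pf pf_trunc. Qed.

Lemma iota_PfS n m (A : nat -> nat -> Ser n) :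
  iota_ser (PfS m A) = pf_aux (fun i j => iota_ser (A i j)) m (iota 1 (2 * m)).
Proof. by rewrite PfS_pf /iota_ser /Pf pf_aux_rmorph. Qed.

Lemma MP_two_neq0 n : (2%:R : MP n) != 0.
Proof.
elim: n => [|n IHn].
  by rewrite -[_ != 0]/((2%:R : {poly int}) != 0) -polyC_natr polyC_eq0.
by rewrite -[_ != 0]/((2%:R : {poly MP n}) != 0) -polyC_natr polyC_eq0.
Qed.

Lemma var_inj n i j : (i < n)%N -> (j < n)%N -> var n i = var n j -> i = j.
Proof.
elim: n => // n IHn; rewrite !ltnS => lin ljn /=.
case: (eqVneq i n) => [->|ni]; case: (eqVneq j n) => [->|nj] //.
- move=> /(congr1 (fun p : {poly MP n} => p`_1)); rewrite coefX coefC /= => /eqP.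
  by rewrite oner_eq0.
- move=> /(congr1 (fun p : {poly MP n} => p`_1)); rewrite coefX coefC /= => /eqP.
  by rewrite eq_sym oner_eq0.
by move=> /polyC_inj; apply: IHn; lia.
Qed.

Lemma var_add_neq0 n i j : (i < n)%N -> (j < n)%N -> var n i + var n j != 0.
Proof.
elim: n => // n IHn; rewrite !ltnS => lin ljn /=.
have key (p q : {poly MP n}) : p`_1 + q`_1 != 0 ->
    (p : MP n.+1) + (q : MP n.+1) != 0.
  by apply: contra_neq => E; rewrite -coefD -[(p + q)%R]/((p : MP n.+1) + q) E coef0.
case: (eqVneq i n) => [_|ni]; case: (eqVneq j n) => [_|nj].
- apply: key; rewrite !coefX /=; exact: MP_two_neq0.
- by apply: key; rewrite coefX coefC /= addr0 oner_neq0.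
- by apply: key; rewrite coefX coefC /= add0r oner_neq0.
rewrite -[X in X != _]/(((var n i)%:P + (var n j)%:P)%R : {poly MP n}) -polyCD polyC_eq0.
by apply: IHn; lia.
Qed.

(** With a = 1 + beta x_k and variables cp t, ck t, the common factor t cancels: the residues have
    no pole at t = 0. *)
Lemma residue_factor (F : fieldType) (a cp ck t : F) : cp - ck != 0 -> t != 0 ->
  a * (cp * a + ck) * (cp - ck)^-1 =
  (a ^+ 2 * (cp * t) + a * (ck * t)) / ((cp - ck) * t).
Proof. by move=> h t0; field; rewrite h t0. Qed.

(** * The Pfaffian in the field of fractions of K[[t]] *)

Section Final.
Variable n : nat.
Local Notation K := {fraction MP n}.
Local Notation PK := (series K).
Local Notation L := {fraction PK}.
Local Notation emb := (@FracField.tofrac PK).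
Local Notation s := (index_enum 'I_n).
Local Notation X := (@xs n).
Local Notation B := (bs n).

(** The differences (x_p - x_k) t are not invertible in K[[t]], so partial fractions are taken in
    L. *)
Definition yL (p : 'I_n) : L := emb (X p).
Definition bL : L := emb B.

Lemma emb_inj : injective emb.
Proof. by move=> u v /eqP; rewrite tofrac_eq => /eqP. Qed.

Lemma xf_inj : injective (@xf n).
Proof.
by move=> p q /eqP; rewrite /xf /toF tofrac_eq => /eqP/var_inj E; apply: val_inj; apply: E.
Qed.

Lemma xf_add_neq0 (p q : 'I_n) : xf p + xf q != 0.
Proof. by rewrite /xf /toF -tofracD tofrac_eq0 var_add_neq0. Qed.

Lemma xs1 p : X p 1%N = xf p.
Proof. by rewrite /xs ps_constM /ps_t mulr1. Qed.

Lemma yL_inj : injective yL.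
Proof.
move=> p q /emb_inj /(congr1 (fun f : PK => f 1%N)); rewrite !xs1.
exact: xf_inj.
Qed.

Lemma coef0_1D (c : K) (f : PK) : ord_ge 1 f -> (ps_const c + f) 0%N = c.
Proof. by move=> H; rewrite ps_addE H // addr0. Qed.

Lemma yLU p : 1 + bL * yL p != 0.
Proof.
rewrite -tofrac1 -tofracM -tofracD tofrac_eq0.
apply: contra_neq (oner_neq0 K) => /(congr1 (fun f : PK => f 0%N)).
by rewrite coef0_1D ?ps_0E //; apply: ord_geMl; apply: ord_xs.
Qed.

Lemma K_two_neq0 : (2%:R : K) != 0.
Proof. by rewrite -(rmorph_nat (@FracField.tofrac (MP n))) tofrac_eq0 MP_two_neq0. Qed.

Lemma emb2 : (2 : L) = emb (ps_const 2).
Proof. by rewrite !rmorph_nat. Qed.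

Lemma L_two_neq0 : (2 : L) != 0.
Proof.
rewrite emb2 tofrac_eq0; apply: contra_neq K_two_neq0.
by move=> /(congr1 (fun f : PK => f 0%N)); rewrite ps_0E.
Qed.

Lemma yL2 p : 2 + bL * yL p != 0.
Proof.
rewrite emb2 -tofracM -tofracD tofrac_eq0.
apply: contra_neq K_two_neq0 => /(congr1 (fun f : PK => f 0%N)).
by rewrite coef0_1D ?ps_0E //; apply: ord_geMl; apply: ord_xs.
Qed.

Lemma yLD p q : fplus bL (yL p) (yL q) != 0.
Proof.
rewrite /fplus -!tofracM -!tofracD tofrac_eq0.
apply: contra_neq (xf_add_neq0 p q) => /(congr1 (fun f : PK => f 1%N)).
rewrite ps_addE ps_0E; have -> : (B * X p * X q) 1%N = 0.
  have H := ord_geM (ord_geM (@ord_ge0 _ B) (ord_xs p)) (ord_xs q).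
  exact: H.
by rewrite addr0 ps_addE !xs1.
Qed.

(* The residue of H at u = x_p, a power series because the factors t of      *)
(* x_p (+) x_k and x_p (-) x_k cancel.                                       *)
Definition residue_series (l : seq 'I_n) (p : 'I_n) : PK :=
  ((1 + B * X p) ^+ 2 * X p + (1 + B * X p) * X p) *
  \prod_(k <- l | k != p)
    ((1 + B * X k) * (ps_const (xf p) * (1 + B * X k) + ps_const (xf k)) *
     ps_const (xf p - xf k)^-1).

Lemma emb_residue_series l p : emb (residue_series l p) = hresidue bL yL l p.
Proof.
rewrite /residue_series tofracM rmorph_prod /hresidue /residue /lin; congr (_ * _).
  have E : emb (1 + B * X p) = 1 + bL * yL p by rewrite tofracD tofracM tofrac1.
  transitivity (emb (1 + B * X p) ^+ 2 * yL p + emb (1 + B * X p) * yL p).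
    by rewrite -tofracXn /yL -!tofracM -tofracD.
  by rewrite E.
apply: eq_bigr => k kp /=.
pose c (u : K) : L := emb (ps_const u).
have yE q : yL q = c (xf q) * emb (ps_t K) by rewrite /yL /xs tofracM.
have t0 : emb (ps_t K) != 0.
  rewrite tofrac_eq0; apply: contra_neq (oner_neq0 K).
  by move=> /(congr1 (fun f : PK => f 1%N)); rewrite ps_0E.
have x0 : xf p - xf k != 0.
  by rewrite subr_eq0; apply: contraNneq kp => /xf_inj ->.
have cD : c (xf p - xf k) = c (xf p) - c (xf k) by rewrite /c rmorphB tofracB.
have cV : c (xf p - xf k)^-1 * (c (xf p) - c (xf k)) = 1.
  rewrite -cD /c -tofracM -tofrac1; congr tofrac.
  transitivity (ps_const ((xf p - xf k)^-1 * (xf p - xf k))).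
    by symmetry; apply: rmorphM.
  by rewrite mulVf.
have d0 : c (xf p) - c (xf k) != 0.
  by apply: contra_eq_neq cV => ->; rewrite mulr0 eq_sym oner_neq0.
have -> : emb ((1 + B * X k) * (ps_const (xf p) * (1 + B * X k) + ps_const (xf k)) *
     ps_const (xf p - xf k)^-1) =
   (1 + bL * yL k) * (c (xf p) * (1 + bL * yL k) + c (xf k)) * c (xf p - xf k)^-1.
  by rewrite /c /bL /yL -tofrac1 -!(tofracM, tofracD).
have -> : c (xf p - xf k)^-1 = (c (xf p) - c (xf k))^-1.
  by apply: (mulIf d0); rewrite cV mulVf.
have -> : yL p - yL k = (c (xf p) - c (xf k)) * emb (ps_t K).
  by rewrite !yE mulrBl.
by rewrite !yE; apply: residue_factor.
Qed.

Lemma emb_hcoef (l : seq 'I_n) q : emb (hcoef B (map X l) q) = hcoef bL (map yL l) q.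
Proof.
transitivity (hcoef (emb B) (map emb (map X l)) q); first exact: hcoef_rmorph.
by rewrite -map_comp.
Qed.

Lemma hcoef_residue_series (l : seq 'I_n) q : uniq l ->
  hcoef B (map X l) q.+1 = \sum_(p <- l) residue_series l p * X p ^+ q.
Proof.
move=> ul; apply: emb_inj; rewrite emb_hcoef.
have [_ ->] := @hcoef_residue _ _ bL yL l ul (in2W yL_inj).
rewrite rmorph_sum; apply: eq_bigr => p _.
by rewrite -emb_residue_series -tofracXn -tofracM.
Qed.

Lemma ord_BX p : ord_ge 1 (B * X p).
Proof. by apply: ord_geMl; apply: ord_xs. Qed.

Lemma emb_entry m nu i j : size nu = m.*2 ->
  (0 < nuAt nu i)%N -> (0 < nuAt nu j)%N ->
  emb (iota_ser (entry n m nu i j)) = bilin (pf_kernel bL yL) (pf_weight bL yL nu) i j.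
Proof.
move=> Hs i0 j0.
rewrite -(entry_bilin yL_inj yLU yLD yL2 L_two_neq0 Hs).
rewrite (@iota_entry n (residue_series s) (fun p => residue_series (rem p s))) //; first last.
- by move=> p q _; apply: hcoef_residue_series; rewrite rem_uniq ?index_enum_uniq.
- by move=> q; apply: hcoef_residue_series; apply: index_enum_uniq.
rewrite rmorph_sum; apply: eq_bigr => p _; rewrite rmorph_sum; apply: eq_bigr => q _ /=.
have M6 (u1 u2 u3 u4 u5 u6 : PK) : emb (u1 * u2 * u3 * u4 * (u5 * u6)) =
  emb u1 * emb u2 * emb u3 * emb u4 * (emb u5 * emb u6) by rewrite !tofracM.
rewrite M6 !tofracXn !emb_residue_series; congr (_ * (_ * _)).
  transitivity (emb (1 + B * X p) ^ (i.+1%:Z - (2 * m)%N%:Z - 1)).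
    by apply: (rmorphXz emb); apply: unit_1D; apply: ord_BX.
  by rewrite tofracD tofracM tofrac1.
transitivity (emb (1 + B * X q) ^ (j%:Z - (2 * m)%N%:Z - 1)).
  by apply: (rmorphXz emb); apply: unit_1D; apply: ord_BX.
by rewrite tofracD tofracM tofrac1.
Qed.

Lemma emb_PfRHS m nu (u0 : 'I_n) : size nu = m.*2 ->
  all (fun a => 0 < a)%N nu -> (size nu <= n)%N ->
  emb (iota_ser (PfRHS n m nu)) =
  \sum_(w | coset_rep (size nu) w) fterm bL nu (fun i => yL (w i)).
Proof.
move=> Hs Hpos Nn.
rewrite -(pf_fterm_sum yL_inj yLU yLD yL2 L_two_neq0 Hs Nn u0).
rewrite /PfRHS iota_PfS.
transitivity (pf_aux (fun i j => emb (iota_ser (entry n m nu i j))) m (iota 1 (2 * m))).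
  exact: pf_aux_rmorph.
rewrite mul2n; apply: eq_pf_aux => i j; rewrite !mem_iota => /andP[i0 iN] /andP[j0 jN].
have pos k : (0 < k)%N -> (k < 1 + m.*2)%N -> (0 < nuAt nu k)%N.
  by move=> k0 kN; apply: (all_nthP 0%N Hpos); rewrite Hs; lia.
by apply: emb_entry => //; apply: pos.
Qed.

End Final.

(** * Polynomiality *)

Lemma homog_inj n : injective (@homog n).
Proof.
move=> p q E; have [D HD] := comp_total p; have [D' HD'] := comp_total q.
rewrite -(HD (maxn D D')) ?leq_maxl // -(HD' (maxn D D')) ?leq_maxr //.
apply: eq_bigr => d _; exact: (congr1 (fun f : series (MP n) => f d) E).
Qed.

Lemma theta_inj n : injective (@theta n).
Proof. by move=> p q /iota_inj /homog_inj. Qed.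

Section Polynomiality.
Variable n : nat.
Local Notation K := {fraction MP n}.
Local Notation PK := (series K).
Local Notation L := {fraction PK}.
Local Notation emb := (@FracField.tofrac PK).

Definition emb_theta (p : MP n) : L := emb (theta p).
HB.instance Definition _ := GRing.RMorphism.copy emb_theta (emb \o @theta n).

Lemma emb_theta_inj : injective emb_theta.
Proof. by move=> p q /emb_inj /theta_inj. Qed.

(** The substitution of t x_i for x_i on rational functions, which puts GQ_nu and the Pfaffian in
    one field. *)
Definition sigma (x : K) : L := frac_ext emb_theta x.
HB.instance Definition _ :=
  GRing.isZmodMorphism.Build K L sigma (frac_ext_zmod emb_theta_inj).
HB.instance Definition _ :=
  GRing.isMonoidMorphism.Build K L sigma (frac_ext_monoid emb_theta_inj).

Lemma sigma_toF (p : MP n) : sigma (toF p) = emb_theta p.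
Proof. exact: (frac_ext_tofrac emb_theta_inj). Qed.
Lemma sigma_xf i : sigma (xf i) = yL i.
Proof. by rewrite /xf sigma_toF /emb_theta theta_var. Qed.
Lemma sigma_betaF : sigma (betaF n) = bL n.
Proof. by rewrite /betaF sigma_toF /emb_theta theta_beta. Qed.

Lemma fterm_rmorph (F F' : fieldType) (phi : {rmorphism F -> F'}) b nu (z : 'I_n -> F) :
  phi (fterm b nu z) = fterm (phi b) nu (fun i => phi (z i)).
Proof.
have plusE u v : phi (fplus b u v) = fplus (phi b) (phi u) (phi v).
  by rewrite /fplus !(rmorphD, rmorphM).
have minusE u v : phi (fminus b u v) = fminus (phi b) (phi u) (phi v).
  by rewrite /fminus plusE fmorph_div rmorphN rmorphD rmorphM rmorph1.
rewrite /fterm rmorph_prod; apply: eq_bigr => i _.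
rewrite !rmorphM rmorphXn plusE; congr (_ * _).
by rewrite rmorph_prod; apply: eq_bigr => j _; rewrite fmorph_div plusE minusE.
Qed.

Lemma GQnuE nu : GQnu n nu =
  \sum_(w | coset_rep (size nu) w) fterm (betaF n) nu (fun i => xf (w i)).
Proof. by []. Qed.

Lemma sigma_GQnu nu : sigma (GQnu n nu) =
  \sum_(w | coset_rep (size nu) w) fterm (bL n) nu (fun i => yL (w i)).
Proof.
rewrite GQnuE rmorph_sum; apply: eq_bigr => w _; rewrite fterm_rmorph.
rewrite -[X in fterm X]/(sigma (betaF n)) sigma_betaF; congr (fterm _ _ _).
by apply: boolp.funext => i; apply: sigma_xf.
Qed.

Definition is_poly (f : K) := exists p, toF p = f.

Lemma is_polyM f g : is_poly f -> is_poly g -> is_poly (f * g).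
Proof. by move=> [p <-] [q <-]; exists (p * q); apply: tofracM. Qed.
Lemma is_polyD f g : is_poly f -> is_poly g -> is_poly (f + g).
Proof. by move=> [p <-] [q <-]; exists (p + q); apply: tofracD. Qed.
Lemma is_polyN f : is_poly f -> is_poly (- f).
Proof. by move=> [p <-]; exists (- p); apply: tofracN. Qed.
Lemma is_polyX f k : is_poly f -> is_poly (f ^+ k).
Proof. by move=> [p <-]; exists (p ^+ k); apply: tofracXn. Qed.
Lemma is_poly1 : is_poly 1. Proof. by exists 1; apply: tofrac1. Qed.
Lemma is_poly0 : is_poly 0. Proof. by exists 0; apply: tofrac0. Qed.
Lemma is_poly_xf i : is_poly (xf i). Proof. by eexists. Qed.
Lemma is_poly_betaF : is_poly (betaF n). Proof. by eexists. Qed.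
Lemma is_poly_fplus f g : is_poly f -> is_poly g -> is_poly (fplus (betaF n) f g).
Proof.
move=> Hf Hg; apply: is_polyD; first exact: is_polyD.
by apply: is_polyM => //; apply: is_polyM => //; apply: is_poly_betaF.
Qed.

(** Running over ordered pairs makes it invariant under permutations without a sign, so it clears
    the denominators of every coset term alike. *)
Definition disc : MP n :=
  \prod_(i < n) \prod_(j < n | j != i) (var n i - var n j).

Lemma betaU (p : 'I_n) : 1 + betaF n * xf p != 0.
Proof.
apply: contra_neq (yLU p) => E.
by rewrite -sigma_xf -sigma_betaF -(rmorph1 sigma) -rmorphM -rmorphD E rmorph0.
Qed.

Lemma disc_fterm nu (w : 'S_n) :
  is_poly (toF disc * fterm (betaF n) nu (fun i => xf (w i))).
Proof.
have -> : toF disc = \prod_(i < n) \prod_(j < n | j != i) (xf (w i) - xf (w j)).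
  rewrite /toF /disc rmorph_prod (reindex_inj (@perm_inj _ w)) /=.
  apply: eq_bigr => i _; rewrite rmorph_prod (reindex_inj (@perm_inj _ w)) /=.
  apply: eq_big => [j|j _]; first by rewrite (inj_eq perm_inj).
  exact: tofracB.
rewrite /fterm [X in _ * X]big_mkcond /= -big_split /=.
elim/big_ind: _ => [|f g|i _]; [exact: is_poly1|exact: is_polyM|].
case: ifP => _; last first.
  rewrite mulr1; elim/big_ind: _ => [|f g|j _]; [exact: is_poly1|exact: is_polyM|].
  by apply: is_polyD; [|apply: is_polyN]; apply: is_poly_xf.
rewrite mulrCA; apply: is_polyM.
  apply: is_polyM; last by apply: is_polyX; apply: is_poly_xf.
  by apply: is_poly_fplus; apply: is_poly_xf.
have -> : \prod_(j < n | (i < j)%N) (fplus (betaF n) (xf (w i)) (xf (w j)) /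
     fminus (betaF n) (xf (w i)) (xf (w j))) =
  \prod_(j < n | j != i) (if (i < j)%N then (fplus (betaF n) (xf (w i)) (xf (w j)) /
     fminus (betaF n) (xf (w i)) (xf (w j))) else 1).
  rewrite -big_mkcondr; apply: eq_bigl => j.
  by rewrite -val_eqE /= neq_ltn; case: ltngtP.
rewrite -big_split; elim/big_ind: _ => [|f g|j ji]; [exact: is_poly1|exact: is_polyM|].
have wij : w i != w j by rewrite (inj_eq perm_inj) eq_sym.
have d : is_poly (xf (w i) - xf (w j)).
  by apply: is_polyD; [|apply: is_polyN]; apply: is_poly_xf.
case: ifP => _; last by rewrite /= mulr1.
rewrite /= (quotE (@xf_inj n) betaU wij) mulrC divfK; last first.
  by rewrite subr_eq0; apply: contraNneq wij => /xf_inj ->.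
apply: is_polyM; last by apply: is_poly_fplus; apply: is_poly_xf.
apply: is_polyD; first exact: is_poly1.
by apply: is_polyM; [apply: is_poly_betaF|apply: is_poly_xf].
Qed.

Lemma disc_GQnu nu : is_poly (toF disc * GQnu n nu).
Proof.
rewrite GQnuE mulr_sumr; elim/big_ind: _ => [|f g|w _].
- exact: is_poly0.
- exact: is_polyD.
exact: disc_fterm.
Qed.

Lemma disc_neq0 : disc != 0.
Proof.
apply/prodf_neq0 => i _; apply/prodf_neq0 => j ji; rewrite subr_eq0.
by apply: contraNneq ji => /var_inj E; apply/eqP/val_inj; symmetry; apply: E.
Qed.

Lemma disc_homogeneous : exists v, homog disc = ps_const disc * ps_t _ ^+ v.
Proof.
pose hom (p : MP n) := exists v, homog p = ps_const p * ps_t _ ^+ v.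
have homM p q : hom p -> hom q -> hom (p * q).
  move=> [u Hu] [v Hv]; exists (u + v)%N.
  transitivity (homog p * homog q); first exact: rmorphM.
  rewrite Hu Hv; have -> : ps_const (p * q) = ps_const p * ps_const q by exact: rmorphM.
  by rewrite exprD; ring.
have hom1 : hom 1 by exists 0%N; rewrite mulr1; apply: rmorph1.
rewrite /disc -/(hom _); elim/big_ind: _ => // i _.
elim/big_ind: _ => // j _; exists 1%N.
transitivity (homog (var n i) - homog (var n j)); first exact: rmorphB.
have -> : ps_const (var n i - var n j) = ps_const (var n i) - ps_const (var n j).
  exact: rmorphB.
by rewrite !homog_var // mulrBl.
Qed.

(** If [disc] has degree v, the component of N in degree v + d is [disc] times f_d. As N has
    finitely many components, a partial sum P of f satisfies disc P = N, and cancelling [homog disc]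
    gives f. *)
Lemma polynomial_of_disc_multiple (f : series (MP n)) (N : MP n) :
  homog disc * f = homog N -> exists2 P, homog P = f & disc * P = N.
Proof.
move=> E; have [v Ev] := disc_homogeneous.
have NE d : Defs.comp d N = if (v <= d)%N then disc * f (d - v)%N else 0.
  transitivity (homog N d) => //; rewrite -E Ev -mulrA ps_constM ps_tXM.
  by case: ifP => _; rewrite ?mulr0.
have [D HD] := comp_total N.
have EP : disc * (\sum_(d < D) f d) = N.
  rewrite -(HD (v + D)%N) ?leq_addl // big_split_ord /= [X in _ = X + _]big1 ?add0r => [|i _].
    by rewrite mulr_sumr; apply: eq_bigr => d _; rewrite NE leq_addr addKn.
  by rewrite NE leqNgt ltn_ord.
exists (\sum_(d < D) f d) => //.
have gv0 : homog disc != 0.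
  by apply: contra_neq disc_neq0 => gv; apply: homog_inj; rewrite gv; symmetry; apply: rmorph0.
apply: (mulfI gv0); rewrite E -EP; symmetry; exact: rmorphM.
Qed.

Lemma GQnu_PfRHS m nu (u0 : 'I_n) : size nu = m.*2 ->
  all (fun a => 0 < a)%N nu -> (size nu <= n)%N ->
  exists P : MP n, toF P = GQnu n nu /\ polyS P = PfRHS n m nu.
Proof.
move=> Hs Hpos Nn; have [N EN] := disc_GQnu nu.
have E : homog disc * (PfRHS n m nu : series (MP n)) = homog N.
  apply: (@iota_inj n); apply: (@emb_inj n).
  transitivity (emb_theta disc * emb (iota_ser (PfRHS n m nu))).
    by rewrite /emb_theta -tofracM -iota_mulS.
  rewrite (emb_PfRHS u0) // -sigma_GQnu -sigma_toF -rmorphM /= -EN.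
  exact: sigma_toF.
have [P EP VP] := polynomial_of_disc_multiple E.
exists P; split => //; apply: (mulfI (x := toF disc)).
  by rewrite /toF tofrac_eq0 disc_neq0.
by rewrite -EN -VP; symmetry; apply: tofracM.
Qed.
End Polynomiality.

Theorem mainTheorem8 (n m : nat) (nu : seq nat)
  (Hsize : size nu = (2 * m)%N)
  (Hstrict : sorted gtn nu)
  (Hpos : all (fun a => 0 < a)%N nu)
  (Hn : (2 * m <= n)%N) :
  exists P : MP n, toF P = GQnu n nu /\ polyS P = PfRHS n m nu.
Proof.
(* A default index u0 exists only if n > 0. For n = 0 the partition is empty and both sides are
   1. *)
case: n Hn => [|n] Hn; last first.
  by apply: (GQnu_PfRHS ord0); rewrite // ?Hsize // mul2n.
have m0 : m = 0%N by case: m Hn {Hsize}.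
subst m; have nu0 : nu = [::] by apply: size0nil.
subst nu; exists 1; split.
  rewrite /toF tofrac1 /GQnu (big_pred1 1%g) => [|w].
    by rewrite /GQterm big_ord0.
  have -> : w = 1%g by apply/permP => -[].
  by rewrite /= eqxx; apply/forallP => -[].
apply: boolp.funext => d; rewrite /PfRHS /PfS /Pf /= coef1.
by case: d.
Qed.
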